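(* The action of $\operatorname{U}_1(\mathcal H_+)=\operatorname{O}_{1,2}(\mathcal V)\cap\operatorname{Sp}_{1,2}(\mathcal V,\Omega)$ on $\operatorname{GL}_{1,2}(\mathcal V)$ by right multiplication preserves the Kähler structure $(\mathrm g_{\mathcal M},\operatorname{J}_{\mathcal M},\omega_{\mathcal M})$ of $\operatorname{GL}_{1,2}(\mathcal V)$.
   Context: $\mathcal V$ is a real infinite-dimensional separable Hilbert space with inner product $\langle\cdot,\cdot\rangle_{\mathcal V}$, and $J$ is a bounded real-linear operator on $\mathcal V$ with $J^2=-\operatorname{id}_{\mathcal V}$ and $\langle Ju,Jv\rangle_{\mathcal V}=\langle u,v\rangle_{\mathcal V}$; $\Omega(u,v)=\langle u,Jv\rangle_{\mathcal V}$. $\mathcal H=\mathcal V\otimes\mathbb C$ is the complexification with its induced Hermitian scalar product, $J$ is extended $\mathbb C$-linearly to $\mathcal H$, and $\mathcal H=\mathcal H_+\oplus\mathcal H_-$ where $\mathcal H_\pm$ is the eigenspace of $J$ for $\pm i$. Complex conjugation of $\mathcal H$ with respect to $\mathcal V$ exchanges $\mathcal H_\pm$; for a bounded operator $A$ set $\bar Au:=\overline{A\bar u}$; $A^*$ is the Hermitian adjoint. $L^1$, $L^2$ denote trace class and Hilbert-Schmidt operators; $\operatorname{Tr}$ is the trace on $\mathcal H$. With block matrices relative to $\mathcal H_+\oplus\mathcal H_-$, $$\mathfrak{gl}_{1,2}(\mathcal V)=\left\{\begin{pmatrix}A_1&A_2\\ \bar A_2&\bar A_1\end{pmatrix}\ \middle|\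 A_1\in L^1(\mathcal H_+),\ A_2\in L^2(\mathcal H_-,\mathcal H_+)\right\},$$ with norm $\|A_1\|_1+\|A_2\|_2$; $\mathcal M_{1,2}(\mathcal V):=\operatorname{id}_{\mathcal H}+\mathfrak{gl}_{1,2}(\mathcal V)$, and $\operatorname{GL}_{1,2}(\mathcal V)$ is the group of invertible elements of $\mathcal M_{1,2}(\mathcal V)$, an open subset of $\mathcal M_{1,2}(\mathcal V)$. All tangent spaces are identified with $\mathfrak{gl}_{1,2}(\mathcal V)$. The (flat, weak) Kähler structure on $\operatorname{GL}_{1,2}(\mathcal V)$ consists of $\mathrm g_{\mathcal M}(V_1,V_2)=\operatorname{Tr}V_1^*V_2$, $\operatorname{J}_{\mathcal M}V_1=JV_1$, $\omega_{\mathcal M}(V_1,V_2)=\operatorname{Tr}V_1^*JV_2$ for $V_1,V_2\in\mathfrak{gl}_{1,2}(\mathcal V)$. $\operatorname{O}_{1,2}(\mathcal V)=\{a\in\operatorname{GL}_{1,2}(\mathcal V)\mid a^*a=\operatorname{id}_{\mathcal H}\}$; $\operatorname{Sp}_{1,2}(\mathcal V,\Omega)=\{a\in\operatorname{GL}_{1,2}(\mathcal V)\mid a^*Ja=J\}$. $\operatorname{U}_1(\mathcal H_+)$ is the group of unitary operators $u$ on $\mathcal H_+$ with $u-\operatorname{id}_{\mathcal H_+}\in L^1(\mathcal H_+)$, identified with $\operatorname{O}_{1,2}(\mathcal V)\cap\operatorname{Sp}_{1,2}(\mathcal V,\Omega)$ via $u\mapsto\begin{pmatrix}u&0\\0&\bar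 u\end{pmatrix}$. *)

(* Defs.v *)
(* MathComp-Analysis development over an arbitrary [R : realType], with complex
   scalars [R[i]] from mathcomp-real-closed. *)
From HB Require Import structures.
From mathcomp Require Import all_boot all_order all_algebra sesquilinear.
From mathcomp Require Import all_classical all_reals all_analysis.
From mathcomp Require Import complex ring.

Set Implicit Arguments.
Unset Strict Implicit.
Unset Printing Implicit Defensive.

Import Order.TTheory GRing.Theory Num.Theory.
Import numFieldNormedType.Exports.

Local Open Scope classical_set_scope.
Local Open Scope ring_scope.

HB.mixin Record hasRealInner (R : realType) V
    of CompleteNormedModule R V := {
  rdot : {dot V for (@idfun R)};
  rdotvv : forall v, rdot v v = `|v| ^+ 2
}.

#[short(type="realHilbertType")]
HB.structure Definition RealHilbert (R : realType) :=
  {V of hasRealInner R V & CompleteNormedModule R V}.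

HB.mixin Record hasOrthoCplxStruct (R : realType) V of RealHilbert R V := {
  Jop : V -> V;
  Jop_linear : linear Jop;
  Jop_continuous : continuous Jop;
  JopK : forall v, Jop (Jop v) = - v;
  Jop_isometry : forall u v : V, rdot (Jop u) (Jop v) = rdot u v
}.

(* A real Hilbert space [V] with an orthogonal complex structure [J]. *)
#[short(type="hilbertJType")]
HB.structure Definition HilbertJ (R : realType) :=
  {V of hasOrthoCplxStruct R V & RealHilbert R V}.

Definition separable (T : topologicalType) :=
  exists2 D : set T, countable D & dense D.

Definition infinite_dimensional (R : nzRingType) (V : lmodType R) :=
  forall (n : nat) (f : 'I_n -> V),
    exists v : V, forall c : 'I_n -> R, v <> \sum_i c i *: f i.

(* As everywhere in [sesquilinear], the scalar product is linear in its first
   and antilinear in its second argument. *)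
HB.mixin Record hasHermitianInner (C : numClosedFieldType) E
    of GRing.Lmodule C E := {
  hdot : {dot E for (@Num.conj C)}
}.

#[short(type="hermitianSpaceType")]
HB.structure Definition HermitianSpace (C : numClosedFieldType) :=
  {E of hasHermitianInner C E & GRing.Lmodule C E}.

(* The notions below are meant for (infinite-dimensional separable) Hilbert
   spaces; completeness is not used to formulate them. *)
Section Operators.
Context {C : numClosedFieldType}.
Implicit Types E F : hermitianSpaceType C.

Definition hnorm E (x : E) : C := sqrtC (hdot x x).

Definition bounded_op E F (A : E -> F) :=
  linear A /\ exists M : C, forall x, hnorm (A x) <= M * hnorm x.

Definition is_adjoint E F (A : E -> F) (B : F -> E) :=
  bounded_op B /\ forall x y, hdot (A x) y = hdot x (B y).

Definition adj E F (A : E -> F) : F -> E := xget (cst 0) (is_adjoint A).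

Definition unitary E (u : E -> E) :=
  [/\ bounded_op u, adj u \o u = id & u \o adj u = id].

Definition positive_op E (P : E -> E) :=
  bounded_op P /\ forall x, 0 <= hdot (P x) x.

(* Orthonormal bases are indexed by [nat] since the spaces at hand are
   separable and infinite-dimensional. *)
Definition orthonormal_basis E (e : nat -> E) :=
  (forall i j, hdot (e i) (e j) = (i == j)%:R) /\
  (forall x, (forall i, hdot x (e i) = 0) -> x = 0).

Definition has_trace E (T : E -> E) (t : C) :=
  forall e : nat -> E, orthonormal_basis e ->
    (fun n => \sum_(k < n) hdot (T (e k)) (e k)) @ \oo --> t.

Definition trace E (T : E -> E) : C := xget 0 (has_trace T).

(* [is_abs A P] : P = |A|, the positive square root of A^* A. *)
Definition is_abs E F (A : E -> F) (P : E -> E) :=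
  positive_op P /\ P \o P = adj A \o A.

Definition has_trace_norm E F (A : E -> F) (t : C) :=
  exists2 P, is_abs A P & has_trace P t.

Definition trace_class E F (A : E -> F) :=
  bounded_op A /\ exists t, has_trace_norm A t.

Definition trace_norm E F (A : E -> F) : C := xget 0 (has_trace_norm A).

(* Tr A^* A is the sum of the |A e_k|^2 over an orthonormal basis. *)
Definition hilbert_schmidt E F (A : E -> F) :=
  bounded_op A /\ exists t, has_trace (adj A \o A) t.

Definition hs_norm E F (A : E -> F) : C := sqrtC (trace (adj A \o A)).

End Operators.

(* The complexification: [(x, y)] stands for x + i y. *)
Definition cplx (R : realType) (V : hilbertJType R) : Type := (V * V)%type.

Section Complexification.
Context {R : realType} (V : hilbertJType R).
Local Notation H := (cplx V).

HB.instance Definition _ := GRing.Zmodule.copy H (V * V)%type.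

Definition cplx_scale (z : R[i]) (u : H) : H :=
  (complex.Re z *: u.1 - complex.Im z *: u.2,
   complex.Re z *: u.2 + complex.Im z *: u.1).

Fact cplx_scaleA a b u : cplx_scale a (cplx_scale b u) = cplx_scale (a * b) u.
Proof.
case: a b u => [a a'] [b b'] [x y]; congr pair => /=;
  rewrite !(scalerBr, scalerDr, scalerBl, scalerDl, scalerA).
- by rewrite opprD [- _ - _ in LHS]addrC addrACA -opprD.
- by rewrite [X in _ + X = _]addrC addrACA.
Qed.

Fact cplx_scale1 : left_id 1 cplx_scale.
Proof. by case=> x y; rewrite /cplx_scale /= !scale1r !scale0r subr0 addr0. Qed.

Fact cplx_scaleDr : right_distributive cplx_scale +%R.
Proof.
move=> a [x y] [x' y']; congr pair => /=; rewrite !scalerDr.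
- by rewrite opprD addrACA.
- by rewrite addrACA.
Qed.

Fact cplx_scaleDl u : {morph cplx_scale^~ u : a b / a + b}.
Proof.
case: u => x y [a a'] [b b']; congr pair => /=; rewrite !scalerDl.
- by rewrite opprD addrACA.
- by rewrite addrACA.
Qed.

HB.instance Definition _ := GRing.Zmodule_isLmodule.Build R[i] H
  cplx_scaleA cplx_scale1 cplx_scaleDr cplx_scaleDl.

Definition cdot (u v : H) : R[i] :=
  Complex (rdot u.1 v.1 + rdot u.2 v.2) (rdot u.2 v.1 - rdot u.1 v.2).


Fact rdotC (x y : V) : rdot x y = rdot y x.
Proof. by rewrite (hermitian_subproof (s := rdot)) expr0 mul1r. Qed.

Fact cdotC (u v : H) : cdot u v = (-1) ^+ false * Num.conj (cdot v u).
Proof.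
rewrite expr0 mul1r /cdot; congr Complex => /=; rewrite ?opprB.
- by congr (_ + _); exact: rdotC.
- by congr (_ - _); exact: rdotC.
Qed.

Fact cdot_linearl (v : H) : linear_for *%R (cdot^~ v).
Proof.
move=> [a b] [x y] [x' y']; rewrite /cdot /=; congr Complex => /=;
  rewrite !(linearDl, linearNl, linearZl_LR) /=; ring.
Qed.

Fact cdot_linearr (u : H) : linear_for (Num.conj \; *%R) (cdot u).
Proof.
move=> a x y; rewrite cdotC (cdot_linearl u a x y) expr0 mul1r rmorphD rmorphM.
by rewrite /= [cdot u x]cdotC [cdot u y]cdotC expr0 !mul1r.
Qed.

Fact cdot_gt0 (u : H) : u != 0 -> 0 < cdot u u.
Proof.
case: u => x y nz; rewrite /cdot /= [rdot y x]rdotC subrr ltcE /= eqxx /=.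
rewrite !rdotvv; case: (eqVneq x 0) nz => [->|x0] nz.
  rewrite normr0 expr0n add0r exprn_gt0// normr_gt0.
  by apply: contraNneq nz => ->.
by rewrite ltr_pwDl ?exprn_ge0// exprn_gt0// normr_gt0.
Qed.

HB.instance Definition _ := bilinear_isBilinear.Build R[i] H H R[i]
  *%R (Num.conj \; *%R) cdot (cdot_linearl, cdot_linearr).
HB.instance Definition _ :=
  isHermitianSesquilinear.Build R[i] H false Num.conj cdot cdotC.
HB.instance Definition _ := isDotProduct.Build R[i] H cdot cdot_gt0.
HB.instance Definition _ := hasHermitianInner.Build R[i] H cdot.

(* The [R[i]]-linear extension of [J]. *)
Definition Jc (u : H) : H := (Jop u.1, Jop u.2).

Definition conjH (u : H) : H := (u.1, - u.2).

Fact Jc_linear : linear Jc.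
Proof.
have JZ a (x : V) : Jop (a *: x) = a *: Jop x.
  have J0 : Jop (0 : V) = 0.
    have := @Jop_linear _ V 1 0 0; rewrite !scale1r addr0 => /eqP.
    by rewrite -subr_eq0 opprD addrA subrr sub0r oppr_eq0 => /eqP.
  by have := @Jop_linear _ V a x 0; rewrite J0 !addr0.
have JD (x y : V) : Jop (x + y) = Jop x + Jop y.
  by have := @Jop_linear _ V 1 x y; rewrite !scale1r.
have JN (x : V) : Jop (- x) = - Jop x by rewrite -scaleN1r JZ scaleN1r.
by move=> [a b] [x y] [x' y']; congr pair => /=; rewrite !JD !JZ ?JN ?JZ.
Qed.

HB.instance Definition _ := GRing.isLinear.Build R[i] H H _ Jc Jc_linear.

Fact JcK (u : H) : Jc (Jc u) = - u.
Proof. by case: u => x y; congr pair; rewrite /= JopK. Qed.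

Fact Jc_conjH (u : H) : Jc (conjH u) = conjH (Jc u).
Proof.
have : Jc (0, u.2) + Jc (0, - u.2) = 0.
  by rewrite -linearD /= -[RHS](linear0 Jc); congr Jc; congr pair => /=;
    rewrite ?addr0 ?subrr.
by move=> /(congr1 snd) /= /eqP; rewrite addrC addr_eq0 => /eqP JN; congr pair.
Qed.

Fact conjHZ (z : R[i]) (u : H) : conjH (z *: u) = Num.conj z *: conjH u.
Proof.
case: z u => a b [x y]; congr pair => /=;
  by rewrite ?scalerN ?scaleNr ?opprK ?opprD ?opprK // addrC.
Qed.

(* [ipm true] = i and [ipm false] = - i. *)
Definition ipm (s : bool) : R[i] := if s then 'i else - 'i.

Definition in_eigJ (s : bool) : {pred H} := fun u => Jc u == ipm s *: u.

(* [eigJ true] is H_+ and [eigJ false] is H_-. *)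
Record eigJ (s : bool) := EigJ { eigJ_val :> H; _ : eigJ_val \in in_eigJ s }.

Section EigenSpace.
Variable s : bool.

HB.instance Definition _ := [isSub for @eigJ_val s].
HB.instance Definition _ := [Choice of eigJ s by <:].

Fact in_eigJ_submod : GRing.submod_closed (in_eigJ s).
Proof.
split; first by rewrite unfold_in linear0 scaler0.
move=> a u v /eqP Ju /eqP Jv; rewrite unfold_in linearP /= Ju Jv scalerDr.
by rewrite !scalerA [a * _]mulrC.
Qed.

HB.instance Definition _ :=
  GRing.isSubmodClosed.Build R[i] H (in_eigJ s) in_eigJ_submod.
HB.instance Definition _ := [SubChoice_isSubLmodule of eigJ s by <:].

Definition edot (u v : eigJ s) : R[i] := cdot u v.

Fact edot_linearl (v : eigJ s) : linear_for *%R (edot^~ v).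
Proof. by move=> a x y; exact: cdot_linearl. Qed.

Fact edot_linearr (u : eigJ s) : linear_for (Num.conj \; *%R) (edot u).
Proof. by move=> a x y; exact: cdot_linearr. Qed.

Fact edotC (u v : eigJ s) : edot u v = (-1) ^+ false * Num.conj (edot v u).
Proof. exact: cdotC. Qed.

Fact edot_gt0 (u : eigJ s) : u != 0 -> 0 < edot u u.
Proof. by move=> u0; exact: cdot_gt0. Qed.

HB.instance Definition _ := bilinear_isBilinear.Build R[i] (eigJ s) (eigJ s)
  R[i] *%R (Num.conj \; *%R) edot (edot_linearl, edot_linearr).
HB.instance Definition _ :=
  isHermitianSesquilinear.Build R[i] (eigJ s) false Num.conj edot edotC.
HB.instance Definition _ := isDotProduct.Build R[i] (eigJ s) edot edot_gt0.
HB.instance Definition _ := hasHermitianInner.Build R[i] (eigJ s) edot.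

Fact proj_subproof (u : H) : 2^-1 *: (u - ipm s *: Jc u) \in in_eigJ s.
Proof.
have ipm2 : ipm s * ipm s = -1.
  by rewrite /ipm; case: (s); rewrite ?mulrNN -expr2 sqrCi.
rewrite unfold_in linearZ linearB linearZ /= JcK scalerN opprK.
rewrite scalerA mulrC -scalerA scalerBr scalerA ipm2 scaleN1r opprK.
by rewrite addrC.
Qed.

(* The projection of H = H_+ (+) H_- onto the eigenspace. *)
Definition projJ (u : H) : eigJ s := EigJ (proj_subproof u).

End EigenSpace.

Fact conj_subproof s (u : eigJ s) : conjH u \in in_eigJ (~~ s).
Proof.
case: u => u /= /eqP Ju; rewrite unfold_in Jc_conjH Ju conjHZ; apply/eqP.
by congr (_ *: _); rewrite /ipm; case: (s); rewrite ?rmorphN /= ?conjCi ?opprK.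
Qed.

Local Notation Hp := (eigJ true).
Local Notation Hm := (eigJ false).

Definition conj_pm (u : Hp) : Hm := EigJ (conj_subproof u).
Definition conj_mp (u : Hm) : Hp := EigJ (conj_subproof u).

Definition bar_pp (A : Hp -> Hp) : Hm -> Hm := conj_pm \o A \o conj_mp.
Definition bar_mp (A : Hm -> Hp) : Hp -> Hm := conj_pm \o A \o conj_pm.

Definition block_op (A : Hp -> Hp) (B : Hm -> Hp) (C : Hp -> Hm) (D : Hm -> Hm)
    (u : H) : H :=
  let up := projJ true u in let um := projJ false u in
  eigJ_val (A up + B um) + eigJ_val (C up + D um).

(* The blocks A_1 and A_2 of an operator on H. *)
Definition blk_pp (X : H -> H) : Hp -> Hp := fun u => projJ true (X u).
Definition blk_mp (X : H -> H) : Hm -> Hp := fun u => projJ true (X u).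

Definition gl12 : set (H -> H) :=
  [set X | exists A1 A2, [/\ trace_class A1, hilbert_schmidt A2
                          & X = block_op A1 A2 (bar_mp A2) (bar_pp A1)]].

(* Both summands are nonnegative reals of [R[i]]. *)
Definition gl12_norm (X : H -> H) : R :=
  complex.Re (trace_norm (blk_pp X) + hs_norm (blk_mp X)).

Definition M12 : set (H -> H) := [set idfun + X | X in gl12].

Definition GL12 : set (H -> H) :=
  [set a | M12 a /\ exists b, [/\ M12 b, a \o b = id & b \o a = id]].

Definition O12 : set (H -> H) := [set a | GL12 a /\ adj a \o a = id].

Definition Sp12 : set (H -> H) := [set a | GL12 a /\ adj a \o Jc \o a = Jc].

Definition U1 : set (Hp -> Hp) :=
  [set u | unitary u /\ trace_class (u - idfun)].

Definition U1_embed (u : Hp -> Hp) : H -> H :=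
  block_op u (cst 0) (cst 0) (bar_pp u).

(* The Kaehler structure; all tangent spaces are identified with gl12.
   On gl12 the traces below are real. *)
Definition gM (X Y : H -> H) : R[i] := trace (adj X \o Y).
Definition JM (X : H -> H) : H -> H := Jc \o X.
Definition omegaM (X Y : H -> H) : R[i] := trace (adj X \o Jc \o Y).

(* [D] is the tangent map at [a], in the Banach space gl12, of the map [f] from
   the open subset [GL12] of the affine space [M12] to itself. *)
Definition is_tangent_map (f : (H -> H) -> (H -> H)) (a : H -> H)
    (D : (H -> H) -> (H -> H)) :=
  [/\ forall X, gl12 X -> gl12 (D X),
      forall (c : R) X Y, gl12 X -> gl12 Y ->
        D (real_complex R c *: X + Y) = real_complex R c *: D X + D Y,
      exists K : R, forall X, gl12 X -> gl12_norm (D X) <= K * gl12_norm X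
    & forall eps : R, 0 < eps -> exists2 delta : R, 0 < delta &
        forall X, gl12 X -> gl12_norm X < delta -> GL12 (a + X) ->
          gl12 (f (a + X) - f a - D X) /\
          gl12_norm (f (a + X) - f a - D X) <= eps * gl12_norm X].

Definition preserves_kaehler (f : (H -> H) -> (H -> H)) :=
  forall a, GL12 a -> exists D, is_tangent_map f a D /\
    forall X Y, gl12 X -> gl12 Y ->
      [/\ gM (D X) (D Y) = gM X Y, D (JM X) = JM (D X)
        & omegaM (D X) (D Y) = omegaM X Y].

Definition right_mul (u : Hp -> Hp) (a : H -> H) : H -> H := a \o U1_embed u.

(* A right action of the group [U1] on the set [GL12]. *)
Definition is_right_action (act : (Hp -> Hp) -> (H -> H) -> (H -> H)) :=
  [/\ forall u a, U1 u -> GL12 a -> GL12 (act u a),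
      forall a, GL12 a -> act id a = a
    & forall u v a, U1 u -> U1 v -> GL12 a -> act (u \o v) a = act v (act u a)].

End Complexification.

Arguments GL12 {R} V.
Arguments O12 {R} V.
Arguments Sp12 {R} V.
Arguments U1 {R} V.

(* Main.v *)
(** Right multiplication by a unitary [U] is the restriction of a linear map, so
    it is its own tangent map; it commutes with left multiplication by [J], and
    [Tr ((XU)^* T (YU)) = Tr (U^* (X^* T Y) U) = Tr (X^* T Y)] because [U]
    permutes the orthonormal bases.  A unitary commuting with [J] has no
    off-diagonal block, so that [O12] and [Sp12] meet in [U1].

    That [GL12] is stable requires sums of trace class operators to be trace
    class.  The positive square root [|C|] is obtained by iteration; a finite
    Gram-Schmidt process replaces the polar decomposition [C = V |C|] on
    finitely many vectors by a finite-rank contraction, which bounds the partial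
    traces of [|A + B|] by [Tr |A| + Tr |B|]. *)

Require Import Defs.
From mathcomp Require Import all_boot all_order all_algebra sesquilinear.
From mathcomp Require Import all_classical all_reals all_analysis.
From mathcomp Require Import complex ring lra.

Set Implicit Arguments.
Unset Strict Implicit.
Unset Printing Implicit Defensive.

Import Order.TTheory GRing.Theory Num.Theory.
Import numFieldNormedType.Exports.

Local Open Scope classical_set_scope.
Local Open Scope ring_scope.

(** The sum to be controlled is the diagonal block of a product:
    [A1 \o u - 1 = (A1 - 1) \o u + (u - 1)]. Since [has_trace] asks for one limit along every
    orthonormal basis, bounding the partial sums for each basis is not enough. Independence of the
    basis comes from writing a positive operator as [S \o S] and exchanging the double sum of
    [|<S e_k, f_j>|^2]; this is where square roots, Parseval and hence completeness enter.

    [adj] and [trace] are choices with a default value, and a [hermitianSpaceType] need not be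
    complete, so an operator may have no adjoint and then [adj A = cst 0]. Lemmas therefore either
    carry an explicit adjoint or split on its existence.

    Separability and infinite dimension of [V] produce an orthonormal basis of H_+ indexed by [nat].
    With it [gl12_norm] vanishes at 0, which the tangent map condition requires because the
    remainder of a linear map is exactly 0. *)

Section LinearMaps.
Context {K : nzRingType} {U W : lmodType K} {A : U -> W} (lA : linear A).

Lemma lin0 : A 0 = 0.
Proof.
have := lA 1 0 0; rewrite !scale1r addr0 => /eqP.
by rewrite -subr_eq0 opprD addrA subrr sub0r oppr_eq0 => /eqP.
Qed.

Lemma linZ a x : A (a *: x) = a *: A x.
Proof. by have := lA a x 0; rewrite lin0 !addr0. Qed.

Lemma linD x y : A (x + y) = A x + A y.
Proof. by have := lA 1 x y; rewrite !scale1r. Qed.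

Lemma linN x : A (- x) = - A x.
Proof. by rewrite -scaleN1r linZ scaleN1r. Qed.

Lemma linB x y : A (x - y) = A x - A y.
Proof. by rewrite linD linN. Qed.

Lemma lin_sum I (r : seq I) (F : I -> U) :
  A (\sum_(i <- r) F i) = \sum_(i <- r) A (F i).
Proof.
by elim: r => [|i r IH]; rewrite ?big_nil ?lin0// !big_cons linD IH.
Qed.

End LinearMaps.

(** * Real parts and squared moduli of complex numbers *)

Section RealPart.
Context {R : realType}.
Implicit Types z w : R[i].

Lemma ReD z w : complex.Re (z + w) = complex.Re z + complex.Re w.
Proof. by case: z; case: w. Qed.

Lemma ReN z : complex.Re (- z) = - complex.Re z.
Proof. by case: z. Qed.

Lemma complexRe_conj z : complex.Re z^* = complex.Re z.
Proof. by case: z. Qed.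

Lemma Re_sum I (r : seq I) (P : pred I) (F : I -> R[i]) :
  complex.Re (\sum_(i <- r | P i) F i) = \sum_(i <- r | P i) complex.Re (F i).
Proof.
by elim/big_rec2: _ => // i a b _ <-; rewrite ReD.
Qed.

Lemma Re_realM (a : R) z : complex.Re (a%:C%C * z) = a * complex.Re z.
Proof. by case: z => x y /=; rewrite mul0r subr0. Qed.

Lemma conj_real (a : R) : (a%:C%C : R[i])^* = a%:C%C.
Proof. exact: conjc_real. Qed.

(** The squared modulus with values in [R], since the norm of [R[i]] takes its values in [R[i]]. *)
Definition sqmod z : R := complex.Re z ^+ 2 + complex.Im z ^+ 2.

Lemma sqmod_ge0 z : 0 <= sqmod z.
Proof. by rewrite addr_ge0 ?sqr_ge0. Qed.

Lemma sqmodC z : sqmod z^* = sqmod z.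
Proof. by case: z => a b; rewrite /sqmod /= sqrrN. Qed.

Lemma sqmodE z : (sqmod z)%:C%C = z * z^*.
Proof. by rewrite add_Re2_Im2 normCK. Qed.

Lemma sqmod_real (a : R) : sqmod a%:C%C = a ^+ 2.
Proof. by rewrite /sqmod /= expr0n addr0. Qed.

End RealPart.

(** * Hermitian spaces: the real scalar product, the norm and Cauchy-Schwarz *)

Section Hermitian.
Context {R : realType} {E : hermitianSpaceType R[i]}.
Implicit Types (x y z : E) (a : R[i]).

Lemma hdotC x y : hdot x y = (hdot y x)^*.
Proof. by rewrite hermC expr0 mul1r. Qed.

Lemma hdotZl a x y : hdot (a *: x) y = a * hdot x y.
Proof. exact: linearZl_LR. Qed.

Lemma hdotZr a x y : hdot x (a *: y) = a^* * hdot x y.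
Proof. exact: linearZr_LR. Qed.

Lemma hdotBl x y z : hdot (x - y) z = hdot x z - hdot y z.
Proof. exact: linearBl. Qed.

Lemma hdotBr x y z : hdot z (x - y) = hdot z x - hdot z y.
Proof. exact: linearBr. Qed.

Lemma hdotDl x y z : hdot (x + y) z = hdot x z + hdot y z.
Proof. exact: linearDl. Qed.

Lemma hdotDr x y z : hdot z (x + y) = hdot z x + hdot z y.
Proof. exact: linearDr. Qed.

Lemma hdotNl x z : hdot (- x) z = - hdot x z.
Proof. exact: linearNl. Qed.

Lemma hdotNr x z : hdot z (- x) = - hdot z x.
Proof. exact: linearNr. Qed.

(** The real part is a symmetric real bilinear form inducing the same norm; estimates on it stay in
    the totally ordered field [R]. *)
Definition rdt x y : R := complex.Re (hdot x y).
Definition nsq x : R := rdt x x.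

Lemma rdtC x y : rdt x y = rdt y x.
Proof. by rewrite /rdt hdotC complexRe_conj. Qed.

Lemma rdtDl x y z : rdt (x + y) z = rdt x z + rdt y z.
Proof. by rewrite /rdt linearDl ReD. Qed.
Lemma rdtDr x y z : rdt z (x + y) = rdt z x + rdt z y.
Proof. by rewrite !(rdtC z) rdtDl. Qed.
Lemma rdtNl x y : rdt (- x) y = - rdt x y.
Proof. by rewrite /rdt linearNl ReN. Qed.
Lemma rdtNr x y : rdt x (- y) = - rdt x y.
Proof. by rewrite !(rdtC x) rdtNl. Qed.
Lemma rdtZl (a : R) x y : rdt (a%:C%C *: x) y = a * rdt x y.
Proof. by rewrite /rdt hdotZl Re_realM. Qed.
Lemma rdtZr (a : R) x y : rdt x (a%:C%C *: y) = a * rdt x y.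
Proof. by rewrite !(rdtC x) rdtZl. Qed.

Lemma hdotxx x : hdot x x = (nsq x)%:C%C.
Proof.
rewrite /nsq /rdt; have : (hdot x x)^* = hdot x x by rewrite -hdotC.
case: (hdot x x) => a b [] /= /eqP; rewrite eq_sym -addr_eq0 -mulr2n.
by rewrite mulrn_eq0 /= => /eqP ->.
Qed.

Lemma nsq_gt0 x : x != 0 -> 0 < nsq x.
Proof. by move=> x0; rewrite -ltcR -hdotxx neq0_dnorm_gt0. Qed.

Lemma nsq0 : nsq (0 : E) = 0.
Proof. by rewrite /nsq /rdt linear0l. Qed.

Lemma nsq_ge0 x : 0 <= nsq x.
Proof. by have [->|/nsq_gt0/ltW//] := eqVneq x 0; rewrite nsq0. Qed.

Lemma nsq_eq0 x : nsq x = 0 -> x = 0.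
Proof. by have [//|/nsq_gt0] := eqVneq x 0; rewrite lt0r => /andP[/eqP]. Qed.

Lemma nsqD x y : nsq (x + y) = nsq x + nsq y + 2 * rdt x y.
Proof. rewrite /nsq !rdtDl !rdtDr [rdt y x]rdtC; ring. Qed.

Lemma nsqN x : nsq (- x) = nsq x.
Proof. by rewrite /nsq rdtNl rdtNr opprK. Qed.

Lemma nsqB x y : nsq (x - y) = nsq x + nsq y - 2 * rdt x y.
Proof. by rewrite nsqD nsqN rdtNr mulrN. Qed.

Lemma nsqBC x y : nsq (x - y) = nsq (y - x).
Proof. by rewrite -nsqN opprB. Qed.

Lemma nsqZ a x : nsq (a *: x) = sqmod a * nsq x.
Proof.
by rewrite /nsq /rdt hdotZl hdotZr mulrA -sqmodE Re_realM.
Qed.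

Definition nrm x : R := Num.sqrt (nsq x).

Lemma nrm_ge0 x : 0 <= nrm x. Proof. exact: sqrtr_ge0. Qed.

Lemma nrm2 x : nrm x ^+ 2 = nsq x. Proof. by rewrite sqr_sqrtr ?nsq_ge0. Qed.

Lemma nrm_le c x : 0 <= c -> (nrm x <= c) = (nsq x <= c ^+ 2).
Proof. by move=> c0; rewrite -nrm2 ler_sqr ?nnegrE ?nrm_ge0. Qed.

Lemma nrm0 : nrm (0 : E) = 0. Proof. by rewrite /nrm nsq0 sqrtr0. Qed.
Lemma nrmN x : nrm (- x) = nrm x. Proof. by rewrite /nrm nsqN. Qed.
Lemma nrmBC x y : nrm (x - y) = nrm (y - x). Proof. by rewrite /nrm nsqBC. Qed.
Lemma nrmZ (a : R) x : 0 <= a -> nrm (a%:C%C *: x) = a * nrm x.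
Proof.
by move=> a0; rewrite /nrm nsqZ sqmod_real sqrtrM ?sqr_ge0// sqrtr_sqr ger0_norm.
Qed.

(** Cauchy-Schwarz: the squared norm of [|y| x - |x| y] equals [2 |x| |y| (|x| |y| - Re <x, y>)]. *)
Lemma rdt_le x y : rdt x y <= nrm x * nrm y.
Proof.
have [->|/nsq_gt0 x0] := eqVneq x 0; first by rewrite /rdt linear0l nrm0 mul0r.
have [->|/nsq_gt0 y0] := eqVneq y 0; first by rewrite /rdt linear0r nrm0 mulr0.
have nx : 0 < nrm x by rewrite sqrtr_gt0.
have ny : 0 < nrm y by rewrite sqrtr_gt0.
have := nsq_ge0 ((nrm y)%:C%C *: x - (nrm x)%:C%C *: y).
rewrite nsqB !nsqZ !sqmod_real rdtZl rdtZr -!nrm2.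
have -> : nrm y ^+ 2 * nrm x ^+ 2 + nrm x ^+ 2 * nrm y ^+ 2 -
  2 * (nrm y * (nrm x * rdt x y)) =
  2 * (nrm x * nrm y) * (nrm x * nrm y - rdt x y) by ring.
by rewrite pmulr_rge0 ?mulr_gt0// subr_ge0.
Qed.

Lemma nrmD x y : nrm (x + y) <= nrm x + nrm y.
Proof.
rewrite nrm_le ?addr_ge0 ?nrm_ge0// nsqD -!nrm2 sqrrD.
by have := rdt_le x y; lra.
Qed.

Lemma nrm_dist x y z : nrm (x - z) <= nrm (x - y) + nrm (y - z).
Proof. by apply: le_trans (nrmD _ _); rewrite addrA subrK. Qed.

Lemma hnormE x : hnorm x = (nrm x)%:C%C.
Proof.
by rewrite /hnorm hdotxx -nrm2 rmorphXn /= sqrCK// ler0c nrm_ge0.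
Qed.

End Hermitian.

(** * Bounded operators *)

Section BoundedOperators.
Context {R : realType} {E F G : hermitianSpaceType R[i]}.

(** The bound in [bounded_op] is an arbitrary complex number, of which only the real part matters in
    a comparison of real numbers; [|Re M| + 1] is a strictly positive constant, which later proofs
    invert. *)
Lemma bounded_opP (E' F' : hermitianSpaceType R[i]) (A : E' -> F') : bounded_op A <->
  linear A /\ exists2 c : R, 0 < c & forall x, nrm (A x) <= c * nrm x.
Proof.
split=> [[lA [M hM]]|[lA [c c0 hc]]]; split=> //.
  have c0 : 0 < `|complex.Re M| + 1 by rewrite ltr_wpDl.
  exists (`|complex.Re M| + 1) => // x; have := hM x; rewrite !hnormE lecE => /andP[_].
  move=> /= /le_trans -> //; rewrite mulrC Re_realM mulrC ler_wpM2r ?nrm_ge0//.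
  by rewrite (le_trans (ler_norm _))// lerDl.
by exists c%:C%C => x; rewrite !hnormE -rmorphM lecR.
Qed.

Lemma bounded_comp (A : F -> G) (B : E -> F) :
  bounded_op A -> bounded_op B -> bounded_op (A \o B).
Proof.
move=> /bounded_opP[lA [c c0 hA]] /bounded_opP[lB [d d0 hB]]; apply/bounded_opP.
split=> [a x y|]; first by rewrite /= lB lA.
exists (c * d) => [|x]; first by rewrite mulr_gt0.
by rewrite (le_trans (hA _))// -mulrA ler_pM2l.
Qed.

Lemma bounded_add (A B : E -> F) :
  bounded_op A -> bounded_op B -> bounded_op (A + B).
Proof.
move=> /bounded_opP[lA [c c0 hA]] /bounded_opP[lB [d d0 hB]]; apply/bounded_opP.
split=> [a x y|].
  rewrite [LHS]/(A _ + B _) lA lB; rewrite /(A + B) /= scalerDr; exact: addrACA.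
exists (c + d) => [|x]; first by rewrite addr_gt0.
by rewrite (le_trans (nrmD _ _))// mulrDl lerD.
Qed.

Lemma bounded_opp (A : E -> F) : bounded_op A -> bounded_op (- A).
Proof.
move=> /bounded_opP[lA [c c0 hA]]; apply/bounded_opP.
split=> [a x y|].
  by change (- A (a *: x + y) = a *: - A x - A y); rewrite lA opprD scalerN.
by exists c => // x; rewrite [(- A) x]/(- A x) nrmN.
Qed.

Lemma bounded_id : bounded_op (id : E -> E).
Proof. by apply/bounded_opP; split=> //; exists 1 => // x; rewrite mul1r. Qed.

Lemma bounded_cst0 : bounded_op (cst 0 : E -> F).
Proof.
apply/bounded_opP; split=> [a x y|]; first by rewrite scaler0 addr0.
by exists 1 => // x; rewrite /= nrm0 mul1r nrm_ge0.
Qed.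

End BoundedOperators.

Lemma bounded_scale (R : realType) (E : hermitianSpaceType R[i]) (c : R) :
  bounded_op ( *:%R c%:C%C : E -> E).
Proof.
apply/bounded_opP; split=> [a x y|].
  by rewrite scalerDr !scalerA [_ * a]mulrC.
exists (`|c| + 1) => [|x]; first by rewrite ltr_wpDl.
rewrite /nrm nsqZ sqmod_real sqrtrM ?sqr_ge0// sqrtr_sqr.
by rewrite ler_wpM2r ?sqrtr_ge0// lerDl.
Qed.

(** * Adjoints *)

Section Adjoints.
Context {R : realType}.
Implicit Types E F G : hermitianSpaceType R[i].

Lemma hdot_injl E (x y : E) : (forall z, hdot x z = hdot y z) -> x = y.
Proof.
move=> xy; apply/eqP; rewrite -subr_eq0; apply/eqP/nsq_eq0.
by rewrite /nsq /rdt hdotBl xy subrr.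
Qed.

Lemma hdot_injr E (x y : E) : (forall z, hdot z x = hdot z y) -> x = y.
Proof. by move=> xy; apply: hdot_injl => z; rewrite hdotC xy -hdotC. Qed.

Lemma is_adjoint_uniq E F (A : E -> F) B B' :
  is_adjoint A B -> is_adjoint A B' -> B = B'.
Proof.
move=> [_ AB] [_ AB']; apply/funext => y.
by apply: hdot_injr => z; rewrite -AB -AB'.
Qed.

Lemma adjE E F (A : E -> F) B : is_adjoint A B -> adj A = B.
Proof. by move=> AB; apply: xget_unique => // B' /is_adjoint_uniq; apply. Qed.

(** Either [adj A] is a true adjoint or it is the default value of the choice; later proofs split
    along this alternative. *)
Lemma adjP E F (A : E -> F) :
  is_adjoint A (adj A) \/ (adj A = cst 0 /\ forall B, ~ is_adjoint A B).
Proof.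
rewrite /adj; case: xgetP => [B -> h|h]; [by left|by right].
Qed.

Lemma is_adjoint_sym E F (A : E -> F) B :
  bounded_op A -> is_adjoint A B -> is_adjoint B A.
Proof.
by move=> bA [bB AB]; split=> // x y; rewrite hdotC -AB -hdotC.
Qed.

Lemma is_adjoint_comp E F G (A : F -> G) (B : E -> F) A' B' :
  is_adjoint A A' -> is_adjoint B B' -> is_adjoint (A \o B) (B' \o A').
Proof.
move=> [bA AA'] [bB BB']; split; first exact: bounded_comp.
by move=> x y; rewrite /= AA' BB'.
Qed.

Lemma is_adjoint_add E F (A B : E -> F) A' B' :
  is_adjoint A A' -> is_adjoint B B' -> is_adjoint (A + B) (A' + B').
Proof.
move=> [bA AA'] [bB BB']; split; first exact: bounded_add.
by move=> x y; rewrite [(A + B) x]/(A x + B x) [(A' + B') y]/(A' y + B' y)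
  hdotDl hdotDr AA' BB'.
Qed.

Lemma is_adjoint_opp E F (A : E -> F) A' :
  is_adjoint A A' -> is_adjoint (- A) (- A').
Proof.
move=> [bA AA']; split; first exact: bounded_opp.
by move=> x y; rewrite [(- A) x]/(- A x) [(- A') y]/(- A' y) hdotNl hdotNr AA'.
Qed.

Lemma is_adjoint_id E : is_adjoint (id : E -> E) id.
Proof. by split => //; exact: bounded_id. Qed.

Lemma is_adjoint_cst0 E F : is_adjoint (cst 0 : E -> F) (cst 0).
Proof.
by split=> [|x y]; [exact: bounded_cst0|rewrite /= linear0l linear0r].
Qed.

End Adjoints.

(** * Finite orthonormal families and Bessel's inequality *)

Section Orthonormal.
Context {R : realType} {E : hermitianSpaceType R[i]}.

Lemma hdot_suml I (r : seq I) (P : pred I) (F : I -> E) (y : E) :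
  hdot (\sum_(i <- r | P i) F i) y = \sum_(i <- r | P i) hdot (F i) y.
Proof. exact: linear_sumlz. Qed.

Lemma hdot_sumr I (r : seq I) (P : pred I) (F : I -> E) (y : E) :
  hdot y (\sum_(i <- r | P i) F i) = \sum_(i <- r | P i) hdot y (F i).
Proof. exact: linear_sumr. Qed.

(** Indexing by a list through [g] lets one list of vectors carry several families, such as its
    images under two operators [Q] and [A]. *)
Definition orthonormal_fam (I : eqType) (r : seq I) (g : I -> E) :=
  uniq r /\ {in r &, forall i j, hdot (g i) (g j) = (i == j)%:R}.

Context {I : eqType} {r : seq I} {g : I -> E} (og : orthonormal_fam r g).

Lemma hdot_orthonormal_sum (c : I -> R[i]) j : j \in r ->
  hdot (\sum_(i <- r) c i *: g i) (g j) = c j.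
Proof.
case: og => ur gr jr; rewrite hdot_suml (bigD1_seq j)//= hdotZl gr// eqxx mulr1.
rewrite big_seq_cond big1 ?addr0// => i /andP[ir ij].
by rewrite hdotZl gr// (negbTE ij) mulr0.
Qed.

Lemma nsq_orthonormal_sum (c : I -> R[i]) :
  nsq (\sum_(i <- r) c i *: g i) = \sum_(i <- r) sqmod (c i).
Proof.
rewrite {1}/nsq /rdt hdot_sumr Re_sum; apply: eq_big_seq => j jr.
by rewrite hdotZr hdot_orthonormal_sum// mulrC -sqmodE.
Qed.

Lemma nsq_orthonormal_rest (x : E) :
  nsq (x - \sum_(i <- r) hdot x (g i) *: g i) =
  nsq x - \sum_(i <- r) sqmod (hdot x (g i)).
Proof.
rewrite nsqB nsq_orthonormal_sum.
have -> : rdt x (\sum_(i <- r) hdot x (g i) *: g i) =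
    \sum_(i <- r) sqmod (hdot x (g i)).
  rewrite /rdt hdot_sumr Re_sum; apply: eq_big_seq => j jr.
  by rewrite hdotZr mulrC -sqmodE.
by ring.
Qed.

Lemma bessel (x : E) : \sum_(i <- r) sqmod (hdot x (g i)) <= nsq x.
Proof. by rewrite -subr_ge0 -nsq_orthonormal_rest nsq_ge0. Qed.

End Orthonormal.

Lemma sqmod_hdot_le (R : realType) (E : hermitianSpaceType R[i]) (x y : E) :
  hdot y y = 1 -> sqmod (hdot x y) <= nsq x.
Proof.
move=> yy; have o : orthonormal_fam [:: tt] (fun=> y).
  by split=> // -[] [] _ _; rewrite yy eqxx.
by have := bessel o x; rewrite big_seq1.
Qed.

(** * Gram-Schmidt and finite-rank contractions *)

Section ContractionLift.
Context {R : realType} {E F G : hermitianSpaceType R[i]}.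
Context {Q : E -> F} {A : E -> G} (lQ : linear Q) (lA : linear A).
Hypothesis QA : forall x y, hdot (Q x) (Q y) = hdot (A x) (A y).

(** The process runs in the source space: coefficients are computed from the images under [Q], but
    the list keeps preimages, to which another operator can be applied later. Expansions found
    earlier survive, because the new image is orthogonal to the old ones and its coefficient is
    0. *)
Lemma gram_schmidt_step (zs : seq E) (x : E) : orthonormal_fam zs Q ->
  Q x != \sum_(z <- zs) hdot (Q x) (Q z) *: Q z ->
  exists z', [/\ orthonormal_fam (z' :: zs) Q,
    Q x = \sum_(z <- z' :: zs) hdot (Q x) (Q z) *: Q z
    & forall y, Q y = \sum_(z <- zs) hdot (Q y) (Q z) *: Q z ->
        Q y = \sum_(z <- z' :: zs) hdot (Q y) (Q z) *: Q z].
Proof.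
move=> oQ; case: (oQ) => uz oz Qx.
pose w := x - \sum_(z <- zs) hdot (Q x) (Q z) *: z.
have Qw : Q w = Q x - \sum_(z <- zs) hdot (Q x) (Q z) *: Q z.
  rewrite (linB lQ) (lin_sum lQ); congr (_ - _).
  by apply: eq_bigr => i _; rewrite (linZ lQ).
have wz z : z \in zs -> hdot (Q w) (Q z) = 0.
  by move=> zz; rewrite Qw hdotBl (hdot_orthonormal_sum oQ) ?subrr.
have Qw0 : Q w != 0 by rewrite Qw subr_eq0.
pose c : R := nrm (Q w); have c0 : 0 < c by rewrite sqrtr_gt0 nsq_gt0.
pose z' := (c^-1)%:C%C *: w.
have Qz' : Q z' = (c^-1)%:C%C *: Q w by rewrite (linZ lQ).
have z'1 : hdot (Q z') (Q z') = 1.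
  rewrite hdotxx Qz' nsqZ sqmod_real -nrm2 -/c -exprMn mulVf ?gt_eqF//.
  by rewrite expr1n.
have z'z z : z \in zs -> hdot (Q z') (Q z) = 0.
  by move=> zz; rewrite Qz' hdotZl wz// mulr0.
have zz' z : z \in zs -> hdot (Q z) (Q z') = 0.
  by move=> zz; rewrite hdotC z'z// conjC0.
have z'n : z' \notin zs.
  by apply/negP => /z'z; rewrite z'1 => /eqP; rewrite oner_eq0.
exists z'; split.
- split=> /=; first by rewrite z'n.
  move=> i j; rewrite !inE => /orP[/eqP->|iz] /orP[/eqP->|jz].
  + by rewrite eqxx.
  + by rewrite z'z//; case: eqP jz z'n => // -> ->.
  + by rewrite zz'//; case: eqP iz z'n => // -> ->.
  + exact: oz.
- rewrite big_cons; apply/eqP; rewrite -subr_eq -Qw; apply/eqP.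
  have -> : hdot (Q x) (Q z') = hdot (Q w) (Q z').
    rewrite Qw hdotBl hdot_suml [X in _ - X]big_seq big1 ?subr0// => z zz.
    by rewrite hdotZl zz' ?mulr0.
  have -> : Q w = c%:C%C *: Q z'.
    by rewrite Qz' scalerA -rmorphM mulfV ?gt_eqF// scale1r.
  by rewrite hdotZl z'1 mulr1.
- move=> y hy; rewrite big_cons.
  rewrite {2}hy hdot_suml big_seq big1 ?scale0r ?add0r//.
  by move=> z zz; rewrite hdotZl zz' ?mulr0.
Qed.

Lemma gram_schmidt (v : nat -> E) N : exists zs : seq E,
  orthonormal_fam zs Q /\ forall k, (k < N)%N ->
    Q (v k) = \sum_(z <- zs) hdot (Q (v k)) (Q z) *: Q z.
Proof.
elim: N => [|N [zs [oz hz]]]; first by exists [::].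
have [QvN|QvN] := eqVneq (Q (v N)) (\sum_(z <- zs) hdot (Q (v N)) (Q z) *: Q z).
  by exists zs; split=> // k; rewrite ltnS leq_eqVlt => /orP[/eqP ->|/hz//].
have [z' [oz' hN hy]] := gram_schmidt_step oz QvN.
exists (z' :: zs); split=> // k.
by rewrite ltnS leq_eqVlt => /orP[/eqP ->//|/hz/hy].
Qed.

(** By [QA], a list [zs] orthonormal under [Q] is orthonormal under [A]. So [W], which sends [Q z]
    to [A z] and kills the complement, and its reverse [W'] are mutually adjoint, and Bessel makes
    them contractions. *)
Lemma contraction_lift (v : nat -> E) N : exists W W',
  [/\ is_adjoint W W' /\ bounded_op W, forall x, nsq (W x) <= nsq x,
      forall y, nsq (W' y) <= nsq y
    & forall k, (k < N)%N -> W (Q (v k)) = A (v k) /\ W' (A (v k)) = Q (v k)].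
Proof.
have [zs [oQ hz]] := gram_schmidt v N.
have oA : orthonormal_fam zs A.
  by case: oQ => uz oz; split=> // i j iz jz; rewrite -QA oz.
pose W x := \sum_(z <- zs) hdot x (Q z) *: A z.
pose W' y := \sum_(z <- zs) hdot y (A z) *: Q z.
have W1 x : nsq (W x) <= nsq x by rewrite (nsq_orthonormal_sum oA) bessel.
have W'1 x : nsq (W' x) <= nsq x by rewrite (nsq_orthonormal_sum oQ) bessel.
have bW : bounded_op W.
  apply/bounded_opP; split=> [a x y|].
    rewrite scaler_sumr -big_split; apply: eq_bigr => z _ /=.
    by rewrite hdotDl hdotZl scalerDl scalerA.
  by exists 1 => // x; rewrite mul1r nrm_le ?nrm_ge0// nrm2.
have bW' : bounded_op W'.
  apply/bounded_opP; split=> [a x y|].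
    rewrite scaler_sumr -big_split; apply: eq_bigr => z _ /=.
    by rewrite hdotDl hdotZl scalerDl scalerA.
  by exists 1 => // x; rewrite mul1r nrm_le ?nrm_ge0// nrm2.
exists W, W'; split=> //.
- split; last exact: bW.
  split; first exact: bW'.
  move=> x y; rewrite hdot_suml hdot_sumr; apply: eq_bigr => z _.
  by rewrite hdotZl hdotZr -hdotC mulrC.
- move=> k kN; split; last first.
    by rewrite [RHS]hz//; apply: eq_bigr => z _; rewrite QA.
  (* The difference is [A] applied to [v k] minus its expansion over [zs]. By [QA] it has the norm
     of the [Q]-image of the same vector, which is 0 by [hz]. *)
  apply/eqP; rewrite eq_sym -subr_eq0; apply/eqP/nsq_eq0.
  have -> : W (Q (v k)) = A (\sum_(z <- zs) hdot (Q (v k)) (Q z) *: z).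
    by rewrite (lin_sum lA); apply: eq_bigr => z _; rewrite (linZ lA).
  rewrite -(linB lA) /nsq /rdt -QA (linB lQ) (lin_sum lQ) {1 3}hz//.
  under [X in _ - X]eq_bigr do rewrite (linZ lQ).
  by rewrite subrr linear0l.
Qed.

End ContractionLift.

(** * Completeness and Parseval's identity *)

Section Completeness.
Context {R : realType} {E : hermitianSpaceType R[i]}.

(** Convergence is spelled out with epsilons, as a [hermitianSpaceType] carries no topology. *)
Definition hcvg (u : nat -> E) (l : E) :=
  forall e : R, 0 < e -> \forall n \near \oo, nrm (u n - l) < e.

Definition hcauchy (u : nat -> E) :=
  forall e : R, 0 < e -> exists N, forall m n,
    (N <= n)%N -> (n <= m)%N -> nrm (u m - u n) < e.

Definition hcomplete := forall u : nat -> E, hcauchy u -> exists l, hcvg u l.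

End Completeness.
Arguments hcomplete {R} E.

(** Feeds both uses of completeness: the partial sums of Fourier coefficients and the scalar
    majorants of the square root iteration. *)
Lemma nondecreasing_bounded_cauchy (R : realType) (a : nat -> R) M :
  (forall n, a n <= a n.+1) -> (forall n, a n <= M) ->
  forall e, 0 < e -> exists N, forall m n, (N <= n)%N -> (n <= m)%N ->
    a m - a n < e.
Proof.
move=> ainc aM e e0.
have hi : nondecreasing_seq a by apply/nondecreasing_seqP.
have ub : has_ubound (range a) by exists M => _ [n _ <-].
have hs : has_sup (range a) by split=> //; exists (a 0%N), 0%N.
have [_ [N _ <-] hN] := sup_adherent e0 hs.
exists N => m n Nn nm.
have : a m <= sup (range a) by apply: ub_le_sup => //; exists m.
by have := hi _ _ Nn; lra.
Qed.

Section Parseval.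
Context {R : realType} {E : hermitianSpaceType R[i]} (cE : hcomplete E).
Context {f : nat -> E} (bf : orthonormal_basis f).

Lemma onb_orthonormal r : uniq r -> orthonormal_fam r f.
Proof. by split=> // i j _ _; case: bf. Qed.

(** [orthonormal_basis] only says that no nonzero vector is orthogonal to the family. By Bessel the
    partial Fourier sums [y n] are Cauchy; their limit [l] has the same coefficients as [x], hence
    equals [x]. Only this half of Parseval is stated, with a slack [d], since Bessel is the other
    half. *)
Lemma parseval_near (x : E) (d : R) : 0 < d ->
  \forall n \near \oo, nsq x < \sum_(j < n) sqmod (hdot x (f j)) + d.
Proof.
move=> d0.
pose s n := \sum_(0 <= j < n) sqmod (hdot x (f j)).
pose y n := \sum_(0 <= j < n) hdot x (f j) *: f j.
have sM n : s n <= nsq x.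
  by apply: bessel; apply: onb_orthonormal; exact: iota_uniq.
have sI n : s n <= s n.+1 by rewrite /s big_nat_recr//= lerDl sqmod_ge0.
have yy m n : (n <= m)%N -> nsq (y m - y n) = s m - s n.
  move=> nm.
  have -> : y m = y n + \sum_(n <= j < m) hdot x (f j) *: f j.
    by rewrite /y -big_cat_nat.
  have -> : s m = s n + \sum_(n <= j < m) sqmod (hdot x (f j)).
    by rewrite /s -big_cat_nat.
  rewrite ![_ + _ - _]addrAC !subrr !add0r.
  by apply: nsq_orthonormal_sum; apply: onb_orthonormal; exact: iota_uniq.
have [l yl] : exists l, hcvg y l.
  apply: cE => e e0; have e2 : 0 < e ^+ 2 by rewrite exprn_gt0.
  have [N hN] := nondecreasing_bounded_cauchy sI sM e2.
  exists N => m n Nn nm; have := hN _ _ Nn nm; rewrite -yy// -nrm2.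
  by rewrite ltr_sqr ?nnegrE ?nrm_ge0 ?ltW.
have xl : x - l = 0.
  case: (bf) => of0 /(_ (x - l)); apply=> j.
  suff h e : 0 < e -> sqmod (hdot (x - l) (f j)) < e ^+ 2.
    suff : sqmod (hdot (x - l) (f j)) = 0.
      rewrite /sqmod => /eqP; rewrite paddr_eq0 ?sqr_ge0// !sqrf_eq0.
      by case: (hdot _ _) => a b /= /andP[/eqP-> /eqP->].
    apply/eqP; rewrite eq_le sqmod_ge0 andbT leNgt; apply/negP => p0.
    have := h (Num.sqrt (sqmod (hdot (x - l) (f j)))).
    by rewrite sqrtr_gt0 => /(_ p0); rewrite sqr_sqrtr ?sqmod_ge0// ltxx.
  move=> e0; near \oo => n.
  have jn : (j < n)%N by near: n; exact: nbhs_infty_gt.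
  (* As soon as [j < n], the vectors [y n] and [x] have the same [j]-th coefficient, so the
     coefficient of [x - l] is as small as [y n - l]. *)
  have -> : hdot (x - l) (f j) = hdot (y n - l) (f j).
    rewrite !hdotBl; congr (_ - _); rewrite hdot_orthonormal_sum//.
      by apply: onb_orthonormal; exact: iota_uniq.
    by rewrite mem_index_iota.
  apply: (le_lt_trans (sqmod_hdot_le _ _)); first by rewrite of0 eqxx.
  rewrite -nrm2 ltr_sqr ?nnegrE ?nrm_ge0 ?ltW//.
  by near: n; exact: yl.
have {xl} xl : x = l by apply/eqP; rewrite -subr_eq0 xl.
near=> n.
have : nsq (x - y n) = nsq x - s n.
  by apply: nsq_orthonormal_rest; apply: onb_orthonormal; exact: iota_uniq.
have : nsq (x - y n) < d.
  rewrite nsqBC xl -nrm2 -[ltRHS]sqr_sqrtr ?(ltW d0)//.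
  rewrite ltr_sqr ?nnegrE ?nrm_ge0 ?sqrtr_ge0//.
  by near: n; apply: yl; rewrite sqrtr_gt0.
by rewrite /s big_mkord; lra.
Unshelve. all: by end_near.
Qed.

(** One [n] serves all [N] vectors, so that the resulting finite double sum can be exchanged. *)
Lemma parseval_sum_near N (x : nat -> E) (d : R) : 0 < d ->
  \forall n \near \oo, \sum_(k < N) nsq (x k) <
    \sum_(k < N) \sum_(j < n) sqmod (hdot (x k) (f j)) + d.
Proof.
elim: N d => [|N IH] d d0; first by near=> n; rewrite !big_ord0 add0r.
have d2 : 0 < d / 2 by rewrite divr_gt0.
near=> n; rewrite !big_ord_recr /=.
have : \sum_(k < N) nsq (x k) <
    \sum_(k < N) \sum_(j < n) sqmod (hdot (x k) (f j)) + d / 2.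
  by near: n; exact: IH.
have : nsq (x N) < \sum_(j < n) sqmod (hdot (x N) (f j)) + d / 2.
  by near: n; exact: parseval_near.
by lra.
Unshelve. all: by end_near.
Qed.

(* Summing [|S T e_k|^2 = sum_j |<e_k, T' S f_j>|^2] over [k] first. *)
Lemma hs_sum_le (S T T' : E -> E) (e : nat -> E) (M : R) N :
  is_adjoint S S -> is_adjoint T T' -> (forall y, nsq (T' y) <= nsq y) ->
  (forall i j, hdot (e i) (e j) = (i == j)%:R) ->
  (forall n, \sum_(j < n) nsq (S (f j)) <= M) ->
  \sum_(k < N) nsq (S (T (e k))) <= M.
Proof.
move=> [_ SS] [_ TT'] T'1 oe hM.
have oeN : orthonormal_fam (index_enum 'I_N) (e : 'I_N -> E).
  by split=> [|i j _ _]; [exact: index_enum_uniq|rewrite oe].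
apply/ler_addgt0Pr => d d0; near \oo => n.
have /ltW/le_trans : \sum_(k < N) nsq (S (T (e k))) <
    \sum_(k < N) \sum_(j < n) sqmod (hdot (S (T (e k))) (f j)) + d.
  by near: n; exact: (parseval_sum_near _ (fun k => S (T (e k)))).
apply; rewrite lerD2r (le_trans _ (hM n))// exchange_big; apply: ler_sum => j _.
apply: le_trans (T'1 _).
under eq_bigr do rewrite SS TT' hdotC sqmodC.
exact: (bessel oeN).
Unshelve. all: by end_near.
Qed.

End Parseval.

(** * Limits in Hermitian spaces *)

Section HilbertLimits.
Context {R : realType} {E : hermitianSpaceType R[i]}.
Implicit Types (u v : nat -> E) (l m : E).

Lemma nrm_lt_eq0 (x : E) : (forall e : R, 0 < e -> nrm x < e) -> x = 0.
Proof.
move=> h; apply: nsq_eq0; rewrite -nrm2; apply/eqP; rewrite sqrf_eq0.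
rewrite eq_le nrm_ge0 andbT leNgt; apply/negP => /h.
by rewrite ltxx.
Qed.

Lemma hcvg_uniq u l m : hcvg u l -> hcvg u m -> l = m.
Proof.
move=> ul um; apply/eqP; rewrite -subr_eq0; apply/eqP/nrm_lt_eq0 => e e0.
have e2 : 0 < e / 2 by rewrite divr_gt0.
near \oo => n; apply: le_lt_trans (nrm_dist l (u n) m) _.
have : nrm (u n - l) < e / 2 by near: n; exact: ul.
have : nrm (u n - m) < e / 2 by near: n; exact: um.
by rewrite (nrmBC l); lra.
Unshelve. all: by end_near.
Qed.

Lemma hcvg_cst l : hcvg (fun=> l) l.
Proof. by move=> e e0; near=> n; rewrite subrr nrm0. Unshelve. all: by end_near. Qed.

Lemma hcvgS u l : hcvg u l -> hcvg (fun n => u n.+1) l.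
Proof.
by move=> ul e /ul [N _ hN]; exists N => // n /= Nn; apply: hN; exact: leqW.
Qed.

Lemma hcvgD u v l m : hcvg u l -> hcvg v m -> hcvg (fun n => u n + v n) (l + m).
Proof.
move=> ul vm e e0; have e2 : 0 < e / 2 by rewrite divr_gt0.
near=> n; rewrite opprD addrACA; apply: le_lt_trans (nrmD _ _) _.
have : nrm (u n - l) < e / 2 by near: n; exact: ul.
have : nrm (v n - m) < e / 2 by near: n; exact: vm.
by lra.
Unshelve. all: by end_near.
Qed.

Lemma hcvgZ (a : R[i]) u l : hcvg u l -> hcvg (fun n => a *: u n) (a *: l).
Proof.
move=> ul e e0; pose d := e / (Num.sqrt (sqmod a) + 1).
have a0 : 0 < Num.sqrt (sqmod a) + 1 by rewrite ltr_wpDl ?sqrtr_ge0.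
have d0 : 0 < d by rewrite divr_gt0.
near=> n; rewrite -scalerBr /nrm nsqZ sqrtrM ?sqmod_ge0//.
apply: (@le_lt_trans _ _ ((Num.sqrt (sqmod a) + 1) * nrm (u n - l))).
  by rewrite ler_wpM2r ?sqrtr_ge0// lerDl.
by rewrite mulrC -ltr_pdivlMr//; near: n; exact: ul.
Unshelve. all: by end_near.
Qed.

Lemma hcvg_nrm_le u l c : (forall n, nrm (u n) <= c) -> hcvg u l -> nrm l <= c.
Proof.
move=> uc ul; apply/ler_addgt0Pr => e e0; near \oo => n.
have : nrm (u n - l) < e by near: n; exact: ul.
have := nrm_dist l (u n) 0; rewrite !subr0 (nrmBC l).
by have := uc n; lra.
Unshelve. all: by end_near.
Qed.

Lemma hcvg_rdt_eq0 u l z : (forall n, rdt (u n) z = 0) -> hcvg u l -> rdt l z = 0.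
Proof.
move=> uz ul.
suff h e : 0 < e -> `|rdt l z| < e.
  apply/eqP; rewrite -normr_le0 leNgt; apply/negP => /h.
  by rewrite ltxx.
move=> e0; have z0 : 0 < nrm z + 1 by rewrite ltr_wpDl ?nrm_ge0.
near \oo => n.
have un : nrm (u n - l) * (nrm z + 1) < e.
  by rewrite -ltr_pdivlMr//; near: n; apply: ul; rewrite divr_gt0.
apply: le_lt_trans un; rewrite ler_norml.
have -> : rdt l z = rdt (l - u n) z by rewrite rdtDl rdtNl uz subr0.
have h1 := rdt_le (l - u n) z.
have := rdt_le (- (l - u n)) z; rewrite rdtNl nrmN => h2.
rewrite (nrmBC _ l) mulrDr mulr1; have h3 := nrm_ge0 (l - u n).
by apply/andP; split; lra.
Unshelve. all: by end_near.
Qed.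

End HilbertLimits.

(** * Positive operators and their square roots *)

Section PositiveOperators.
Context {R : realType} {E : hermitianSpaceType R[i]} {P : E -> E}.
Hypothesis pP : positive_op P.

Lemma positive_linear : linear P. Proof. by case: pP => -[]. Qed.

(** In [R[i]], [0 <= z] forces [z] to be real; reality of [<P z, z>] at [x], [y], [x + y] and
    [x + i y] gives the symmetry by polarization. *)
Lemma positive_is_adjoint : is_adjoint P P.
Proof.
case: pP => bP p0; split=> // x y; have lP := positive_linear.
have Im0 z : complex.Im (hdot (P z) z) = 0.
  by have := p0 z; rewrite lecE => /andP[/eqP].
have := Im0 (x + y); have := Im0 (x + 'i *: y); have := Im0 x; have := Im0 y.
rewrite !(linD lP) !(linZ lP) !(hdotDl, hdotDr, hdotZl, hdotZr) -complexiE.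
rewrite [hdot x (P y)]hdotC.
case: (hdot (P x) x) (hdot (P y) y) (hdot (P x) y) (hdot (P y) x) =>
  [a a'] [b b'] [c c'] [d d'] /=.
by move=> h1 h2 h3 h4; congr Complex; lra.
Qed.

Lemma positive_rdt_ge0 x : 0 <= rdt (P x) x.
Proof. by case: pP => _ /(_ x); rewrite lecE => /andP[]. Qed.

(* Evaluate the form at [x - P x / c]. *)
Lemma positive_nsq_le c : 0 < c -> (forall x, nrm (P x) <= c * nrm x) ->
  forall x, nsq (P x) <= c * rdt (P x) x.
Proof.
move=> c0 hP x; have lP := positive_linear.
have := positive_rdt_ge0 (x - (c^-1)%:C%C *: P x).
rewrite (linB lP) (linZ lP) rdtDl !rdtDr !rdtNl !rdtNr !rdtZl !rdtZr opprK.
have -> : rdt (P (P x)) x = nsq (P x).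
  by rewrite /nsq /rdt; case: positive_is_adjoint => _ ->.
rewrite -/(nsq (P x)).
have : rdt (P (P x)) (P x) <= c * nsq (P x).
  apply: le_trans (rdt_le _ _) _; rewrite -nrm2 expr2 mulrA.
  by rewrite ler_wpM2r ?nrm_ge0.
have ci : 0 < c^-1 by rewrite invr_gt0.
move: (rdt (P (P x)) (P x)) => w hw.
have : c^-1 * (c^-1 * w) <= c^-1 * nsq (P x).
  rewrite ler_pM2l// mulrC ler_pdivrMr// mulrC //.
move=> h1 h2; have h3 : 0 <= rdt (P x) x - c^-1 * nsq (P x) by lra.
rewrite -subr_ge0.
have -> : c * rdt (P x) x - nsq (P x) = c * (rdt (P x) x - c^-1 * nsq (P x)).
  by rewrite mulrBr mulrA mulfV ?gt_eqF// mul1r.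
by rewrite mulr_ge0// ltW.
Qed.

End PositiveOperators.

(* The square root of [1 - X] is [1 - Y], where [Y] is the limit of
   [Y_(n+1) = (X + Y_n^2) / 2].  The differences of the [Y_n] are bounded by
   those of the scalar iteration at [X = 1], since
   [Y_n^2 - Y_(n-1)^2 = Y_n (Y_n - Y_(n-1)) + (Y_n - Y_(n-1)) Y_(n-1)]. *)
Section SquareRootIteration.
Context {R : realType} {E : hermitianSpaceType R[i]} (cE : hcomplete E).
Context {X : E -> E} (lX : linear X) (X1 : forall x, nrm (X x) <= nrm x).
Hypothesis XX : forall x y, hdot (X x) y = hdot x (X y).
Local Notation half := ((2^-1 : R)%:C%C).

Fixpoint sqrt_iter n (x : E) : E :=
  if n is k.+1 then half *: (X x + sqrt_iter k (sqrt_iter k x)) else 0.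
Fixpoint sqrt_bound n : R :=
  if n is k.+1 then 2^-1 * (1 + sqrt_bound k ^+ 2) else 0.

Local Notation Y := sqrt_iter.
Local Notation y := sqrt_bound.

Lemma sqrt_iter_linear n : linear (Y n).
Proof.
elim: n => [|n IH] a u v /=; first by rewrite scaler0 addr0.
rewrite lX !IH addrACA -scalerDr [LHS]scalerDr; congr (_ + _).
by rewrite !scalerA mulrC.
Qed.

Lemma sqrt_iter_adjoint n u v : hdot (Y n u) v = hdot u (Y n v).
Proof.
elim: n u v => [|n IH] u v /=; first by rewrite linear0l linear0r.
by rewrite hdotZl hdotZr hdotDl hdotDr XX !IH conj_real.
Qed.

Lemma sqrt_bound_ge0 n : 0 <= y n.
Proof. by case: n => //= n; rewrite mulr_ge0 ?addr_ge0 ?sqr_ge0 ?invr_ge0. Qed.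

Lemma sqrt_bound_le1 n : y n <= 1.
Proof. by elim: n => //= n IH; have := sqrt_bound_ge0 n; nra. Qed.

Lemma sqrt_bound_nondecreasing n : y n <= y n.+1.
Proof.
elim: n => [|n IH] /=; first by rewrite expr0n addr0 mulr1 invr_ge0.
move: IH => /=; have := sqrt_bound_ge0 n; set z := _ * _ => z0 yz.
by rewrite ler_pM2l// lerD2l ler_sqr ?nnegrE// (le_trans z0).
Qed.

Lemma half_ge0 : (0 : R) <= 2^-1. Proof. by rewrite invr_ge0. Qed.

Lemma sqrt_iter_nrm n x : nrm (Y n x) <= y n * nrm x.
Proof.
elim: n x => [|n IH] x /=; first by rewrite nrm0 mul0r.
rewrite nrmZ ?half_ge0// -mulrA ler_pM2l// mulrDl mul1r.
apply: le_trans (nrmD _ _) _; apply: lerD => //.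
apply: le_trans (IH _) _; rewrite expr2 -mulrA ler_wpM2l ?sqrt_bound_ge0//.
Qed.

Lemma sqrt_iter_step n x : nrm (Y n.+1 x - Y n x) <= (y n.+1 - y n) * nrm x.
Proof.
elim: n x => [|n IH] x.
  by rewrite subr0 (le_trans (sqrt_iter_nrm 1 x))// subr0.
have lY := sqrt_iter_linear.
have -> : Y n.+2 x - Y n.+1 x = half *: (Y n.+1 (Y n.+1 x - Y n x)
    + (Y n.+1 (Y n x) - Y n (Y n x))).
  rewrite [Y n.+2 x]/= [in X in _ - X]/= -scalerBr; congr (_ *: _).
  rewrite opprD addrACA subrr add0r (linB (lY n.+1)).
  by rewrite addrA subrK.
rewrite nrmZ ?half_ge0//.
have -> : (y n.+2 - y n.+1) * nrm x = 2^-1 *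
    (y n.+1 * ((y n.+1 - y n) * nrm x) + (y n.+1 - y n) * (y n * nrm x)).
  have -> : y n.+2 - y n.+1 = 2^-1 * (y n.+1 ^+ 2 - y n ^+ 2).
    have h1 : y n.+2 = 2^-1 * (1 + y n.+1 ^+ 2) by [].
    have h2 : y n.+1 = 2^-1 * (1 + y n ^+ 2) by [].
    by rewrite h1 [X in _ - X]h2 -mulrBr opprD addrACA subrr add0r.
  by move: (y n.+1) (y n) => z z'; ring.
rewrite ler_pM2l//; apply: le_trans (nrmD _ _) _; apply: lerD.
  apply: le_trans (sqrt_iter_nrm _ _) _.
  by rewrite ler_wpM2l ?sqrt_bound_ge0.
apply: le_trans (IH _) _; rewrite ler_wpM2l ?sqrt_iter_nrm//.
by rewrite subr_ge0 sqrt_bound_nondecreasing.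
Qed.

Lemma sqrt_iter_dist m n x : (n <= m)%N ->
  nrm (Y m x - Y n x) <= (y m - y n) * nrm x.
Proof.
elim: m => [|m IH]; first by rewrite leqn0 => /eqP->; rewrite !subrr nrm0 mul0r.
rewrite leq_eqVlt => /orP[/eqP->|]; first by rewrite !subrr nrm0 mul0r.
rewrite ltnS => /IH h; apply: le_trans (nrm_dist _ (Y m x) _) _.
apply: le_trans (lerD (sqrt_iter_step _ _) h) _.
by rewrite -mulrDl addrA subrK.
Qed.

Lemma sqrt_iter_cvg x : exists l, hcvg (Y^~ x) l.
Proof.
apply: cE => e e0; have x0 : 0 < nrm x + 1 by rewrite ltr_wpDl ?nrm_ge0.
have e1 : 0 < e / (nrm x + 1) by rewrite divr_gt0.
have [N hN] := nondecreasing_bounded_cauchy sqrt_bound_nondecreasing sqrt_bound_le1 e1.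
exists N => m n Nn nm; apply: le_lt_trans (sqrt_iter_dist _ nm) _.
have := hN _ _ Nn nm; rewrite ltr_pdivlMr//; apply: le_lt_trans.
rewrite ler_wpM2l ?lerDl// subr_ge0.
elim: (m) nm => [|k IH]; first by rewrite leqn0 => /eqP->.
rewrite leq_eqVlt => /orP[/eqP->//|/IH/le_trans]; apply.
exact: sqrt_bound_nondecreasing.
Qed.

(** The last clause says [(1 - Z)^2 = 1 - X]; contractivity and reality of the form make [1 - Z]
    positive. *)
Lemma sqrt_limit : exists Z : E -> E,
  [/\ linear Z, forall x, nrm (Z x) <= nrm x,
      forall x, complex.Im (hdot (Z x) x) = 0
    & forall x, 2 *: Z x = X x + Z (Z x)].
Proof.
have /choice[Z hZ] := sqrt_iter_cvg.
have lY := sqrt_iter_linear.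
have Y1 n x : nrm (Y n x) <= nrm x.
  apply: le_trans (sqrt_iter_nrm _ _) _.
  by rewrite ler_piMl ?nrm_ge0// sqrt_bound_le1.
exists Z; split.
- move=> a u v; apply: hcvg_uniq (hZ (a *: u + v)) _.
  have := hcvgD (hcvgZ a (hZ u)) (hZ v).
  by congr hcvg; apply/funext => n; rewrite (lY n).
- by move=> x; apply: hcvg_nrm_le (hZ x).
(* [rdt (Z x) ('i *: x)] is the imaginary part of [<Z x, x>], written as a real form so that its
   vanishing passes to the limit. *)
- move=> x; suff : rdt (Z x) ('i *: x) = 0.
    by rewrite /rdt hdotZr -complexiE; case: (hdot _ _) => a b /=; lra.
  apply: hcvg_rdt_eq0 (hZ x) => n.
  rewrite /rdt hdotZr -complexiE.
  have : hdot (Y n x) x = (hdot (Y n x) x)^* by rewrite -hdotC -sqrt_iter_adjoint.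
  by case: (hdot _ _) => a b /= [] ?; lra.
- move=> x.
  (* The [Y n] converge pointwise; their common bound 1 allows [Y n x] to be replaced by [Z x]
     inside [Y n]. *)
  have YY : hcvg (fun n => Y n (Y n x)) (Z (Z x)).
    move=> e e0; have e2 : 0 < e / 2 by rewrite divr_gt0.
    near=> n; apply: le_lt_trans (nrm_dist _ (Y n (Z x)) _) _.
    have h1 : nrm (Y n (Y n x) - Y n (Z x)) < e / 2.
      rewrite -(linB (lY n)); apply: le_lt_trans (Y1 _ _) _.
      by near: n; exact: hZ.
    have : nrm (Y n (Z x) - Z (Z x)) < e / 2 by near: n; exact: hZ.
    by lra.
  have h := hcvg_uniq (hcvgS (hZ x)) (hcvgZ half (hcvgD (@hcvg_cst _ _ (X x)) YY)).
  rewrite {1}h scalerA.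
  have -> : (2 : R[i]) * half = 1.
    by rewrite -[2](rmorph_nat (real_complex R)) -rmorphM mulfV.
  by rewrite scale1r.
Unshelve. all: by end_near.
Qed.

End SquareRootIteration.

(** With [c] a bound of [P], the operator [X = 1 - P / c] is symmetric, and it is a contraction
    because [|P x|^2 <= c <P x, x>]. The iteration gives [(1 - Z)^2 = P / c], whence the root
    [sqrt c (1 - Z)]. *)
Lemma positive_sqrt (R : realType) (E : hermitianSpaceType R[i])
    (cE : hcomplete E) (P : E -> E) :
  positive_op P -> exists S, positive_op S /\ S \o S = P.
Proof.
move=> pP; have lP := positive_linear pP.
case: (pP) => /bounded_opP[_ [c c0 hc]] _.
have PP := positive_nsq_le pP c0 hc.
have ci : 0 < c^-1 by rewrite invr_gt0.
pose X x := x - (c^-1)%:C%C *: P x.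
have lX : linear X.
  move=> a u v; rewrite /X lP scalerDr opprD addrACA; congr (_ + _).
  by rewrite scalerBr !scalerA mulrC.
have X1 x : nrm (X x) <= nrm x.
  rewrite nrm_le ?nrm_ge0// nrm2 /X nsqB nsqZ sqmod_real rdtZr rdtC.
  have h1 : c^-1 * (c^-1 * nsq (P x)) <= c^-1 * rdt (P x) x.
    by rewrite ler_pM2l// mulrC ler_pdivrMr// mulrC.
  have h2 : 0 <= c^-1 * rdt (P x) x by rewrite mulr_ge0 ?positive_rdt_ge0 ?ltW.
  by rewrite expr2 -mulrA; lra.
have XX x y : hdot (X x) y = hdot x (X y).
  rewrite /X hdotBl hdotBr hdotZl hdotZr conj_real.
  by case: (positive_is_adjoint pP) => _ ->.
have [Z [lZ Z1 ZI hZ]] := sqrt_limit cE lX X1 XX.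
pose s : R := Num.sqrt c.
exists (fun x => s%:C%C *: (x - Z x)); split.
  split.
    apply: (@bounded_comp _ _ _ _ ( *:%R s%:C%C) (fun x => x - Z x)).
      exact: bounded_scale.
    apply: (@bounded_add _ _ _ id (- Z)); first exact: bounded_id.
    apply: bounded_opp; apply/bounded_opP; split=> //.
    by exists 1 => // x; rewrite mul1r.
  move=> x; rewrite hdotZl mulr_ge0 ?ler0c ?sqrtr_ge0//.
  rewrite hdotBl lecE hdotxx; have /= := ZI x.
  have := rdt_le (Z x) x; rewrite /rdt; case: (hdot (Z x) x) => a b /= hab ->.
  rewrite oppr0 addr0 eqxx /= subr_ge0 (le_trans hab)// -nrm2 expr2.
  by rewrite ler_wpM2r ?nrm_ge0.
apply/funext => x /=.
rewrite (linZ lZ) (linB lZ) -scalerBr scalerA -rmorphM -expr2 sqr_sqrtr ?ltW//.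
have -> : x - Z x - (Z x - Z (Z x)) = x - (2 *: Z x - Z (Z x)).
  by rewrite scaler_nat mulr2n !opprD !opprK !addrA.
by rewrite hZ addrK /X opprB addrC subrK scalerA -rmorphM mulfV ?gt_eqF// scale1r.
Qed.

Lemma comp_at (X Y Z : Type) (f : Y -> Z) (g : X -> Y) (h : X -> Z) :
  f \o g = h -> forall x, f (g x) = h x.
Proof. by move=> <-. Qed.

(** * Traces of positive operators *)

Section Traces.
Context {R : realType} {E : hermitianSpaceType R[i]}.

Lemma has_traceP (T : E -> E) t : has_trace T t <->
  forall e, orthonormal_basis e -> forall d : R, 0 < d ->
    \forall n \near \oo, `|t - \sum_(k < n) hdot (T (e k)) (e k)| < d%:C%C.
Proof.
split=> h e /h {}h; first by move=> d d0; move/cvgrPdist_lt: h; apply; rewrite ltcR.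
apply/cvgrPdist_lt => -[a b]; rewrite ltcE /= => /andP[/eqP-> a0].
exact: h.
Qed.

Lemma has_trace_cst0 : has_trace (cst 0 : E -> E) 0.
Proof.
move=> e _; rewrite [X in X @ _](_ : _ = cst 0); first exact: cvg_cst.
by apply/funext => n; rewrite big1// => k _; rewrite linear0l.
Qed.

Lemma positive_cst0 : positive_op (cst 0 : E -> E).
Proof. by split=> [|x]; [exact: bounded_cst0|rewrite /= linear0l]. Qed.

Section PositiveTrace.
Context {P : E -> E} (pP : positive_op P).

Lemma positive_hdot x : hdot (P x) x = (rdt (P x) x)%:C%C.
Proof.
case: pP => _ /(_ x); rewrite lecE /rdt => /andP[/eqP].
by case: (hdot _ _) => a b /= ->.
Qed.

Lemma positive_trace_bound t e n : has_trace P t -> orthonormal_basis e ->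
  \sum_(k < n) rdt (P (e k)) (e k) <= complex.Re t.
Proof.
move=> /has_traceP Pt /Pt he; apply/ler_addgt0Pr => d d0.
near \oo => m; have nm : (n <= m)%N by near: m; exact: nbhs_infty_ge.
have : `|t - \sum_(k < m) hdot (P (e k)) (e k)| < d%:C%C by near: m; exact: he.
move/(le_lt_trans (normc_ge_Re _)); rewrite ltcR ReD ReN Re_sum => h.
have : \sum_(k < n) rdt (P (e k)) (e k) <= \sum_(k < m) rdt (P (e k)) (e k).
  rewrite -!(big_mkord xpredT (fun k => rdt (P (e k)) (e k))).
  rewrite [leRHS](@big_cat_nat _ _ _ n)//= lerDl.
  by apply: sumr_ge0 => k _; exact: positive_rdt_ge0.
move: h; rewrite ltr_norml /rdt => /andP[h1 h2]; lra.
Unshelve. all: by end_near.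
Qed.

(* If there is no orthonormal basis, [has_trace] holds vacuously. *)
Lemma positive_has_trace (cE : hcomplete E) (M : R) :
  (forall e n, orthonormal_basis e -> \sum_(k < n) rdt (P (e k)) (e k) <= M) ->
  exists t, has_trace P t.
Proof.
move=> hM.
have [[f bf]|nof] := pselect (exists f : nat -> E, orthonormal_basis f); last first.
  by exists 0 => e be; case: nof; exists e.
have [S [pS SS]] := positive_sqrt cE pP.
have PS x : rdt (P x) x = nsq (S x).
  by rewrite -SS /nsq /rdt /=; case: (positive_is_adjoint pS) => _ ->.
pose s (e : nat -> E) n := \sum_(k < n) rdt (P (e k)) (e k).
have sup_s e : orthonormal_basis e -> has_sup (range (s e)).
  move=> be; split; first by exists (s e 0%N), 0%N.
  by exists M => _ [n _ <-]; exact: hM.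
(* [hs_sum_le] at [T = T' = id]: partial sums along one basis stay below the supremum along any
   other. By symmetry all the suprema coincide, so one limit serves every basis. *)
have s_sup e e' : orthonormal_basis e -> orthonormal_basis e' ->
    forall n, s e n <= sup (range (s e')).
  move=> be be' n; rewrite /s.
  under eq_bigr do rewrite PS.
  apply: (@hs_sum_le _ _ cE _ be' S id id _ _ _ (positive_is_adjoint pS)
    (@is_adjoint_id _ E)) => //; first by case: be.
  move=> m; have -> : \sum_(j < m) nsq (S (e' j)) = s e' m.
    by apply: eq_bigr => j _; rewrite PS.
  by apply: ub_le_sup; [case: (sup_s _ be')|exists m].
exists (sup (range (s f)))%:C%C; apply/has_traceP => e be d d0.
have [_ [N _ <-] hN] := sup_adherent d0 (sup_s _ be).
exists N => // n /= Nn.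
have -> : \sum_(k < n) hdot (P (e k)) (e k) = (s e n)%:C%C.
  by rewrite rmorph_sum; apply: eq_bigr => k _; rewrite positive_hdot.
have se : sup (range (s f)) <= sup (range (s e)).
  by apply: ge_sup => [|_ [m _ <-]]; [exists (s f 0%N), 0%N|exact: s_sup].
have sN : s e N <= s e n.
  rewrite /s -!(big_mkord xpredT (fun k => rdt (P (e k)) (e k))).
  rewrite [leRHS](@big_cat_nat _ _ _ N)//= lerDl.
  by apply: sumr_ge0 => k _; exact: positive_rdt_ge0.
have sf := s_sup _ _ be bf n.
rewrite -rmorphB normc_def /= expr0n addr0 sqrtr_sqr ltcR ger0_norm ?subr_ge0//.
by move: hN; lra.
Qed.

End PositiveTrace.
End Traces.

(** * Sums of trace class operators *)

Section TraceClass.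
Context {R : realType} {E F : hermitianSpaceType R[i]} (cE : hcomplete E).

(** Both sides equal [<x, adj A (A y)>], by symmetry of [Q]. This is the hypothesis under which
    [contraction_lift] applies to [Q = |A|]. *)
Lemma abs_hdot (A : E -> F) A' Q : is_adjoint A A' -> is_abs A Q ->
  forall x y, hdot (Q x) (Q y) = hdot (A x) (A y).
Proof.
move=> AA' [pQ QQ] x y; case: (positive_is_adjoint pQ) => _ ->.
have := comp_at QQ y; rewrite /= (adjE AA') => ->.
by case: AA' => _ ->.
Qed.

(* Writing [A = W Q] on the finitely many vectors involved and [Q = S^2], each
   term is [<S e_k, S W' V e_k>], to which AM-GM applies. *)
Lemma trace_norm_bound (A : E -> F) A' Q t (V : E -> F) V' e N :
  bounded_op A -> is_adjoint A A' -> is_abs A Q -> has_trace Q t ->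
  is_adjoint V V' -> (forall y, nsq (V' y) <= nsq y) -> orthonormal_basis e ->
  \sum_(k < N) rdt (A (e k)) (V (e k)) <= complex.Re t.
Proof.
move=> [lA _] AA' AQ Qt VV' V'1 be; case: (AQ) => pQ _.
have [W [W' [[WW bW] W1 W'1 hW]]] :=
  contraction_lift (positive_linear pQ) lA (abs_hdot AA' AQ) e N.
have [S [pS SS]] := positive_sqrt cE pQ.
have aS := positive_is_adjoint pS.
have QS x y : rdt (Q x) y = rdt (S x) (S y).
  by rewrite -SS /rdt /=; case: aS => _ ->.
have bQ n : \sum_(k < n) nsq (S (e k)) <= complex.Re t.
  apply: le_trans (positive_trace_bound pQ n Qt be).
  by apply: ler_sum => k _; rewrite QS.
have T'1 y : nsq ((V' \o W) y) <= nsq y by apply: le_trans (V'1 _) (W1 _).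
have W'W := is_adjoint_sym bW WW.
have oe i j : hdot (e i) (e j) = (i == j)%:R by case: be.
(* Here [T = W' \o V], whose adjoint [V' \o W] is a contraction; so the sums of [|S e_k|^2] and of
   [|S W' V e_k|^2] are both at most [Re t], and so is their mean. *)
have := hs_sum_le cE be N aS (is_adjoint_comp W'W VV') T'1 oe bQ.
have := bQ N.
suff : \sum_(k < N) rdt (A (e k)) (V (e k)) <=
    2^-1 * (\sum_(k < N) nsq (S (e k)) + \sum_(k < N) nsq (S ((W' \o V) (e k)))).
  by lra.
rewrite -big_split mulr_sumr; apply: ler_sum => k _ /=.
rewrite -(hW _ (ltn_ord k)).1.
have -> : rdt (W (Q (e k))) (V (e k)) = rdt (S (e k)) (S (W' (V (e k)))).
  by rewrite -QS /rdt; case: WW => _ ->.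
have := nsq_ge0 (S (e k) - S (W' (V (e k)))); rewrite nsqB.
by lra.
Qed.

(** [adj A \o A] is then [cst 0], whose positive root [cst 0] has trace 0. This covers the default
    value of [adj] as well as the genuine zero operator. *)
Lemma trace_class_no_adjoint (A : E -> F) :
  bounded_op A -> adj A = cst 0 -> trace_class A.
Proof.
move=> bA A0; split=> //; exists 0, (cst 0); last exact: has_trace_cst0.
by split; [exact: positive_cst0|rewrite A0].
Qed.

(* On the first [n] vectors of a basis, [|C| e_k = V' C e_k] for a finite-rank
   contraction [V], so that the partial traces of [|C|] split into
   [<A e_k, V e_k>] and [<B e_k, V e_k>]. *)
Lemma trace_class_add_adjoint (A B : E -> F) A' B' :
  is_adjoint A A' -> is_adjoint B B' ->
  trace_class A -> trace_class B -> trace_class (A + B).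
Proof.
move=> AA' BB' [bA [a [QA absA trA]]] [bB [b [QB absB trB]]].
have bC := bounded_add bA bB; split=> //.
have CC' := is_adjoint_add AA' BB'.
have pCC : positive_op ((A' + B') \o (A + B)).
  split; first by case: CC' => bC' _; exact: bounded_comp.
  move=> x; have [_ CC] := is_adjoint_sym bC CC'.
  by rewrite [hdot _ _]CC hdotxx ler0c nsq_ge0.
have [P [pP PP]] := positive_sqrt cE pCC.
have absC : is_abs (A + B) P by split=> //; rewrite (adjE CC').
suff [t trP] : exists t, has_trace P t by exists t, P.
apply: (positive_has_trace pP cE (M := complex.Re a + complex.Re b)) => e n be.
have lC : linear (A + B) by case: bC.
have [V [V' [[VV _] V1 V'1 hV]]] :=
  contraction_lift (positive_linear pP) lC (abs_hdot CC' absC) e n.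
apply: le_trans (lerD (trace_norm_bound n bA AA' absA trA VV V'1 be)
  (trace_norm_bound n bB BB' absB trB VV V'1 be)).
rewrite -big_split; apply: ler_sum => k _ /=.
rewrite -(hV _ (ltn_ord k)).2 -rdtDl.
rewrite rdtC /rdt; case: VV => _ <-.
by rewrite -/(rdt _ _) rdtC.
Qed.

(* An operator without adjoint is trace class, as [adj] is [0] on it. *)
Lemma trace_class_add (A B : E -> F) B' : is_adjoint B B' ->
  trace_class A -> trace_class B -> trace_class (A + B).
Proof.
move=> BB' tA tB; have bC : bounded_op (A + B).
  by apply: bounded_add; [case: tA|case: tB].
have [CC|[C0 _]] := adjP (A + B); last exact: trace_class_no_adjoint.
(* If [A + B] has an adjoint, so does [A = (A + B) - B]. *)
have := is_adjoint_add CC (is_adjoint_opp BB'); rewrite addrK => AA'.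
exact: trace_class_add_adjoint AA' BB' tA tB.
Qed.

End TraceClass.

(** * Adjoints, traces and norms under composition with unitaries *)

Section UnitaryInvariance.
Context {R : realType}.
Implicit Types E F G : hermitianSpaceType R[i].

(** If [adj u] were the default [cst 0], then [adj u \o u = id] would force [E = 0], where [cst 0]
    is an adjoint anyway. *)
Lemma unitary_is_adjoint E (u : E -> E) : unitary u -> is_adjoint u (adj u).
Proof.
move=> [bu u'u _]; have [//|[u0 _]] := adjP u.
have E0 x : x = 0 :> E.
  by have := comp_at u'u x; rewrite u0.
rewrite u0; split; first exact: bounded_cst0.
by move=> x y; rewrite (E0 x) (E0 (u 0)) !linear0l.
Qed.

Lemma unitaryP E (u u' : E -> E) : bounded_op u -> is_adjoint u u' ->
  u' \o u = id -> u \o u' = id -> unitary u.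
Proof. by move=> bu uu' h1 h2; rewrite /unitary (adjE uu'). Qed.

Lemma unitary_adj E (u : E -> E) : unitary u -> unitary (adj u).
Proof.
move=> uu; have [bu h1 h2] := uu; have a := unitary_is_adjoint uu.
apply: (@unitaryP _ (adj u) u) => //; first by case: a.
exact: is_adjoint_sym.
Qed.

Lemma adj_unitary E (u : E -> E) : unitary u -> adj (adj u) = u.
Proof.
by move=> uu; apply/adjE/is_adjoint_sym; [case: uu|exact: unitary_is_adjoint].
Qed.

Lemma unitary_opp E (u : E -> E) : unitary u -> unitary (- u).
Proof.
move=> uu; have [bu h1 h2] := uu; have [bu' _] := unitary_is_adjoint uu.
apply: (unitaryP (bounded_opp bu) (is_adjoint_opp (unitary_is_adjoint uu))).
  apply/funext => x; have [lu' _] := bu'.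
  change (- adj u (- u x) = x); rewrite (linN lu') opprK.
  exact: (comp_at h1 x).
apply/funext => x; have [lu _] := bu.
change (- u (- adj u x) = x); rewrite (linN lu) opprK.
exact: (comp_at h2 x).
Qed.

Lemma unitary_onb E (u : E -> E) e :
  unitary u -> orthonormal_basis e -> orthonormal_basis (u \o e).
Proof.
move=> uu [oe me]; have [_ h1 h2] := uu; have [_ h] := unitary_is_adjoint uu.
have u'u x : adj u (u x) = x := comp_at h1 x.
have uu' x : u (adj u x) = x := comp_at h2 x.
split=> [i j|x hx]; first by rewrite /= h u'u oe.
have [_ h'] := unitary_is_adjoint (unitary_adj uu).
rewrite adj_unitary// in h'.
have : adj u x = 0 by apply: me => i; rewrite h' hx.
by rewrite -{2}[x]uu' => ->; apply: lin0; case: uu => -[].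
Qed.

Section Conjugation.
Context {E : hermitianSpaceType R[i]} {u : E -> E} (uu : unitary u).

Lemma has_trace_conj (T : E -> E) t :
  has_trace T t -> has_trace (adj u \o T \o u) t.
Proof.
move=> hT e be.
have <- : (fun n => \sum_(k < n) hdot (T ((u \o e) k)) ((u \o e) k)) =
    (fun n => \sum_(k < n) hdot ((adj u \o T \o u) (e k)) (e k)).
  apply/funext => n; apply: eq_bigr => k _ /=.
  have [_ h] := unitary_is_adjoint (unitary_adj uu).
  by rewrite h adj_unitary.
exact: hT (unitary_onb uu be).
Qed.

End Conjugation.

Lemma has_trace_conjE E (u : E -> E) (uu : unitary u) (T : E -> E) t :
  has_trace (adj u \o T \o u) t = has_trace T t.
Proof.
apply/propext; split=> [h|]; last exact: has_trace_conj.
have [_ _ h2] := uu; have := has_trace_conj (unitary_adj uu) h.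
have -> // : adj (adj u) \o (adj u \o T \o u) \o adj u = T.
rewrite adj_unitary//; apply/funext => x /=.
have uu' z : u (adj u z) = z := comp_at h2 z.
by rewrite !uu'.
Qed.

Lemma trace_conj E (u : E -> E) (uu : unitary u) (T : E -> E) :
  trace (adj u \o T \o u) = trace T.
Proof.
by rewrite /trace; congr xget; apply/funext => t; exact: has_trace_conjE.
Qed.

(** [A \o u] has an adjoint exactly when [A] has one, since [adj u] undoes [u]; if neither has, both
    sides are [cst 0]. *)
Lemma adj_comp_unitary E F (u : E -> E) (A : E -> F) :
  unitary u -> adj (A \o u) = adj u \o adj A.
Proof.
move=> uu; have a := unitary_is_adjoint uu; have [bu h1 h2] := uu.
have [AA|[A0 nA]] := adjP A; first by apply: adjE; exact: is_adjoint_comp.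
have [AuB|[-> _]] := adjP (A \o u).
  case: (nA (u \o adj (A \o u))).
  have a' := unitary_is_adjoint (unitary_adj uu); rewrite adj_unitary// in a'.
  have := is_adjoint_comp AuB a'; rewrite -compA h2.
  by have -> : A \o id = A by [].
rewrite A0; apply/funext => y /=; rewrite (lin0 (A := adj u))//.
by case: a => -[].
Qed.

Lemma adj_unitary_compK E F (u : F -> F) (A : E -> F) :
  unitary u -> adj (u \o A) \o (u \o A) = adj A \o A.
Proof.
move=> uu; have a := unitary_is_adjoint uu; have [bu h1 h2] := uu.
have [AA|[A0 nA]] := adjP A.
  rewrite (adjE (is_adjoint_comp a AA)); apply/funext => x /=.
  by rewrite [adj u (u _)](comp_at h1 (A x)).
have [uAB|[-> _]] := adjP (u \o A); last by rewrite A0.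
case: (nA (adj (u \o A) \o u)).
have a' := unitary_is_adjoint (unitary_adj uu); rewrite adj_unitary// in a'.
have := is_adjoint_comp a' uAB; rewrite compA h1.
by have -> : id \o A = A by [].
Qed.

Lemma trace_class_unitary_comp E F (u : F -> F) (A : E -> F) :
  unitary u -> trace_class A -> trace_class (u \o A).
Proof.
move=> uu [bA [t [P [pP PP] tP]]].
split; first by apply: bounded_comp => //; case: uu.
by exists t, P => //; split=> //; rewrite adj_unitary_compK.
Qed.

Lemma positive_conj E (u : E -> E) P :
  unitary u -> positive_op P -> positive_op (adj u \o P \o u).
Proof.
move=> uu [bP P0]; have [bu _] := uu; have [bu' h] := unitary_is_adjoint uu.
split; first by apply: bounded_comp => //; exact: bounded_comp.
move=> x /=; have [_ ->] := unitary_is_adjoint (unitary_adj uu).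
by rewrite adj_unitary.
Qed.

(** The absolute value of [A \o u] is the conjugate [adj u \o P \o u] of that of [A], and
    conjugation keeps the trace. *)
Lemma has_trace_norm_unitary E F (u : E -> E) (A : E -> F) t :
  unitary u -> has_trace_norm A t -> has_trace_norm (A \o u) t.
Proof.
move=> uu [P [pP PP] tP]; have [_ _ h2] := uu.
exists (adj u \o P \o u); last exact: has_trace_conj.
split; first exact: positive_conj.
rewrite adj_comp_unitary//; apply/funext => x /=.
rewrite [u (adj u _)](comp_at h2 (P (u x))).
by congr (adj u _); exact: (comp_at PP (u x)).
Qed.

Lemma comp_unitaryK E F (u : E -> E) (A : E -> F) :
  unitary u -> A \o u \o adj u = A.
Proof. by move=> [_ _ h2]; rewrite -compA h2. Qed.

Lemma trace_norm_unitary E F (u : E -> E) (A : E -> F) :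
  unitary u -> trace_norm (A \o u) = trace_norm A.
Proof.
move=> uu; rewrite /trace_norm; congr xget; apply/funext => t; apply/propext.
split; last exact: has_trace_norm_unitary.
by move/(has_trace_norm_unitary (unitary_adj uu)); rewrite comp_unitaryK.
Qed.

Lemma trace_class_comp_unitary E F (u : E -> E) (A : E -> F) :
  unitary u -> trace_class A -> trace_class (A \o u).
Proof.
move=> uu [bA [t tA]]; split; first by apply: bounded_comp => //; case: uu.
by exists t; exact: has_trace_norm_unitary.
Qed.

Lemma adj_comp_comp_unitary E F (u : E -> E) (A B : E -> F) : unitary u ->
  adj (A \o u) \o (B \o u) = adj u \o (adj A \o B) \o u.
Proof. by move=> uu; rewrite adj_comp_unitary. Qed.

Lemma hilbert_schmidt_comp_unitary E F (u : E -> E) (A : E -> F) :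
  unitary u -> hilbert_schmidt A -> hilbert_schmidt (A \o u).
Proof.
move=> uu [bA [t tA]]; split; first by apply: bounded_comp => //; case: uu.
by exists t; rewrite adj_comp_comp_unitary// has_trace_conjE.
Qed.

Lemma hs_norm_unitary E F (u : E -> E) (A : E -> F) :
  unitary u -> hs_norm (A \o u) = hs_norm A.
Proof.
by move=> uu; rewrite /hs_norm adj_comp_comp_unitary// trace_conj.
Qed.

Lemma hilbert_schmidt_cst0 E F : hilbert_schmidt (cst 0 : E -> F).
Proof.
split; first exact: bounded_cst0.
by exists 0; rewrite (adjE (is_adjoint_cst0 _ _)); exact: has_trace_cst0.
Qed.

End UnitaryInvariance.

(** * Existence of an orthonormal basis and uniqueness of the trace *)

Section OrthonormalBasis.
Context {R : realType} {E : hermitianSpaceType R[i]}.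

(** Gram-Schmidt along the total sequence [d]. When [d k] already lies in the span, a vector outside
    it, given by [hinf], is inserted instead: each stage adds exactly one vector, so the basis is
    indexed by all of [nat]. *)
Lemma orthonormal_basis_exists (d : nat -> E) :
  (forall x, (forall n, hdot x (d n) = 0) -> x = 0) ->
  (forall l : seq E, exists x, x != \sum_(z <- l) hdot x z *: z) ->
  exists f : nat -> E, orthonormal_basis f.
Proof.
move=> hd hinf.
pose spans (l : seq E) x := x = \sum_(z <- l) hdot x z *: z.
(* A state is the stage and the list built so far. The claim is conditional on orthonormality so
   that [choice] gives a function on all states. *)
have step (kl : nat * seq E) : exists z, orthonormal_fam kl.2 id ->
    orthonormal_fam (z :: kl.2) id /\ spans (z :: kl.2) (d kl.1).
  case: kl => k l /=; have [ol|nol] := pselect (orthonormal_fam l id); last by exists 0.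
  have lid : linear (id : E -> E) by [].
  have [dk|dk] := eqVneq (d k) (\sum_(z <- l) hdot (d k) z *: z).
    have [x xl] := hinf l.
    by have [z [oz _ hz]] := gram_schmidt_step lid ol xl; exists z; split=> //; exact: hz.
  by have [z [oz hz _]] := gram_schmidt_step lid ol dk; exists z.
have [g hg] := choice step.
pose fix M (k : nat) : seq E := if k is n.+1 then g (n, M n) :: M n else [::].
pose f k := g (k, M k).
have oM k : orthonormal_fam (M k) id.
  by elim: k => [|k IH] //=; case: (hg (k, M k) IH).
have fM i j : (i < j)%N -> f i \in M j.
  elim: j => // j IH; rewrite ltnS leq_eqVlt /= inE => /orP[/eqP->|/IH->].
    by rewrite eqxx.
  by rewrite orbT.
have Mf k w : w \in M k -> exists i, w = f i.
  by elim: k => // k IH /=; rewrite inE => /orP[/eqP->|/IH//]; exists k.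
(* The lists [M k] are indexed by their own vectors, so [oM] compares vectors; injectivity of [f]
   turns this into a comparison of indices. *)
have f_lt i j : (i < j)%N -> f j != f i.
  move=> /fM fi; have [/= /andP[fj _] _] := oM j.+1.
  by apply: contra fj => /eqP; rewrite -/(f j) => ->.
exists f; split=> [i j|x hx]; last first.
  apply: hd => k; have [_ ->] := hg (k, M k) (oM k).
  rewrite -[_ :: _]/(M k.+1) hdot_sumr big_seq big1// => w /Mf[i ->].
  by rewrite hdotZr hx mulr0.
have [_ o] := oM (maxn i j).+1; rewrite o ?fM ?ltnS ?leq_max ?leqnn ?orbT//.
congr ((nat_of_bool _)%:R); apply/eqP/eqP => [fij|->//].
case: (ltngtP i j) => // /f_lt/eqP h; [case: (h (esym fij))|case: (h fij)].
Qed.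

Lemma has_trace_uniq (f : nat -> E) (T : E -> E) s t : orthonormal_basis f ->
  has_trace T s -> has_trace T t -> s = t.
Proof. by move=> bf /(_ _ bf) sT /(_ _ bf) tT; exact: cvg_unique sT tT. Qed.

(** In the order of [R[i]] this includes that [t] is real, which holds because [t] is a limit of
    real sums; the empty partial sum bounds its real part below. *)
Lemma positive_trace_ge0 (f : nat -> E) (P : E -> E) t : orthonormal_basis f ->
  positive_op P -> has_trace P t -> 0 <= t.
Proof.
move=> bf pP tP; rewrite lecE /=; apply/andP; split; last first.
  by have := positive_trace_bound pP 0 tP bf; rewrite big_ord0.
rewrite -normr_le0; apply/ler_addgt0Pr => e e0; rewrite add0r.
move/has_traceP: tP => /(_ _ bf _ e0) [N _ /(_ N)] /(_ (leqnn _)).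
rewrite (eq_bigr (fun k : 'I_N => (rdt (P (f k)) (f k))%:C%C)); last first.
  by move=> k _; rewrite positive_hdot.
rewrite -rmorph_sum normc_def ltcR; move: (\sum_(k < N) _) => r.
case: t => a b /=; rewrite subr0 => /ltW; apply: le_trans.
by rewrite -sqrtr_sqr ler_wsqrtr// lerDr sqr_ge0.
Qed.

End OrthonormalBasis.

(** * The eigenspaces of [J]: completeness and bases *)

Section EigenspaceBasis.
Context {R : realType} {V : hilbertJType R}.
Local Notation H := (cplx V).

Lemma nsq_cplx (u : H) : nsq u = `|u.1| ^+ 2 + `|u.2| ^+ 2.
Proof. by rewrite -!rdotvv. Qed.

Lemma nsq_eigJ s (p : eigJ V s) : nsq p = nsq (p : H).
Proof. by []. Qed.

Lemma hdot_eigJ s (p q : eigJ V s) : hdot p q = hdot (p : H) (q : H).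
Proof. by []. Qed.

Lemma eigJP s (p : eigJ V s) : Jc p = ipm s *: (p : H).
Proof. by case: p => p /= /eqP. Qed.

(** Both components of a Cauchy sequence converge in the complete space [V], and continuity of [Jop]
    passes the eigenvalue equation to the limit. *)
Lemma eigJ_complete s : hcomplete (eigJ V s).
Proof.
move=> u cu.
have le1 (x y : H) : `|x.1 - y.1| <= nrm (x - y).
  by rewrite -[leLHS]ger0_norm// -sqrtr_sqr ler_wsqrtr// nsq_cplx lerDl sqr_ge0.
have le2 (x y : H) : `|x.2 - y.2| <= nrm (x - y).
  by rewrite -[leLHS]ger0_norm// -sqrtr_sqr ler_wsqrtr// nsq_cplx lerDr sqr_ge0.
have cv (g : H -> V) : (forall x y : H, `|g x - g y| <= nrm (x - y)) ->
    exists l : V, (fun n => g (u n)) @ \oo --> l.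
  move=> hg; suff : cvg ((fun n => g (u n)) @ \oo) by move=> h; eexists; exact: h.
  apply: cauchy_cvg; apply: cauchy_exP => e e0; have [N hN] := cu e e0.
  exists (g (u N)); exists N => // n /= Nn.
  rewrite -ball_normE /ball_ /= distrC; apply: le_lt_trans (hg _ _) _.
  exact: hN.
have [l1 ul1] := cv (fun x => x.1) le1.
have [l2 ul2] := cv (fun x => x.2) le2.
pose l : H := (l1, l2).
have lE : l \in in_eigJ s.
  rewrite unfold_in; apply/eqP; congr pair.
    apply: (@cvg_unique V (@norm_hausdorff R V) ((fun n => Jop (eigJ_val (u n)).1) @ \oo)).
      by apply: (cvg_comp _ _ ul1); exact: Jop_continuous.
    have -> : (fun n => Jop (eigJ_val (u n)).1) =
        fun n => complex.Re (ipm s) *: (eigJ_val (u n)).1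
                 - complex.Im (ipm s) *: (eigJ_val (u n)).2.
      by apply/funext => n; exact: (congr1 fst (eigJP (u n))).
    by apply: cvgB; apply: cvgZr.
  apply: (@cvg_unique V (@norm_hausdorff R V) ((fun n => Jop (eigJ_val (u n)).2) @ \oo)).
    by apply: (cvg_comp _ _ ul2); exact: Jop_continuous.
  have -> : (fun n => Jop (eigJ_val (u n)).2) =
      fun n => complex.Re (ipm s) *: (eigJ_val (u n)).2
               + complex.Im (ipm s) *: (eigJ_val (u n)).1.
    by apply/funext => n; exact: (congr1 snd (eigJP (u n))).
  by apply: cvgD; apply: cvgZr.
exists (EigJ lE) => e e0; have e2 : 0 < e / 2 by rewrite divr_gt0.
near=> n.
have h1 : `|l1 - (eigJ_val (u n)).1| < e / 2.
  by near: n; move/cvgrPdist_lt: ul1; apply.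
have h2 : `|l2 - (eigJ_val (u n)).2| < e / 2.
  by near: n; move/cvgrPdist_lt: ul2; apply.
rewrite -[e]gtr0_norm// -sqrtr_sqr ltr_sqrt ?exprn_gt0// nsqBC nsq_eigJ nsq_cplx /=.
have k1 : `|l1 - (eigJ_val (u n)).1| ^+ 2 < (e / 2) ^+ 2.
  by rewrite ltr_sqr ?nnegrE ?normr_ge0 ?(ltW e2).
have k2 : `|l2 - (eigJ_val (u n)).2| ^+ 2 < (e / 2) ^+ 2.
  by rewrite ltr_sqr ?nnegrE ?normr_ge0 ?(ltW e2).
apply: lt_le_trans (ltrD k1 k2) _.
have -> : e ^+ 2 = (e / 2) ^+ 2 + (e / 2) ^+ 2 + 2 * (e / 2) ^+ 2 by field.
by rewrite lerDl mulr_ge0 ?sqr_ge0.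
Unshelve. all: by end_near.
Qed.

Local Notation Hp := (eigJ V true).
Local Notation Hm := (eigJ V false).

Lemma ipm_true : ipm true = Complex 0 1 :> R[i].
Proof. by rewrite /ipm -complexiE. Qed.

Fact real_to_Hp_subproof (v : V) : ((v, - Jop v) : H) \in in_eigJ true.
Proof.
rewrite unfold_in ipm_true; apply/eqP; congr pair => /=.
  by rewrite scale0r scale1r sub0r opprK.
by rewrite (linN Jop_linear) JopK opprK scale0r scale1r add0r.
Qed.

(* [v |-> v - i J v], twice the projection of [V] to [H_+]. *)
Definition real_to_Hp (v : V) : Hp := EigJ (real_to_Hp_subproof v).

(** [J (x + i y) = i (x + i y)] reads [J x = - y], so taking the real part identifies H_+ with
    [V]. *)
Lemma HpE (p : Hp) : eigJ_val p = ((eigJ_val p).1, - Jop (eigJ_val p).1).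
Proof.
have := congr1 fst (eigJP p); rewrite ipm_true /= scale0r scale1r sub0r => ->.
by rewrite opprK; case: (eigJ_val p).
Qed.

Lemma real_to_HpK (p : Hp) : real_to_Hp (eigJ_val p).1 = p.
Proof. by apply: val_inj; rewrite /= -HpE. Qed.

Lemma nsq_real_to_Hp_sub (v w : V) :
  nsq (real_to_Hp v - real_to_Hp w) = 2 * `|v - w| ^+ 2.
Proof.
rewrite nsq_eigJ nsq_cplx /= -opprD -(linB Jop_linear) normrN.
by rewrite -!rdotvv Jop_isometry mulr_natl mulr2n.
Qed.

(** A countable dense subset of [V], enumerated by [v], is carried to H_+. If [x] is orthogonal to
    the images, then [|x|^2 = Re <x, x - w> <= |x| |x - w|] for images [w] as close to [x] as
    desired. *)
Lemma Hp_total (V_separable : separable V) :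
  exists d : nat -> Hp, forall x, (forall n, hdot x (d n) = 0) -> x = 0.
Proof.
have [D /countable_injP[g gD] dD] := V_separable.
pose v n := xget 0 [set w | D w /\ g w = n].
have vD w : D w -> v (g w) = w.
  move=> Dw; apply: xget_unique => //= w' [Dw' gw].
  by apply: gD; rewrite ?inE.
exists (real_to_Hp \o v) => x hx; apply: nrm_lt_eq0 => e e0.
(* [real_to_Hp] stretches distances by [sqrt 2 < 2], hence half of [e] is close enough in [V]. *)
have [r r0 er] : exists2 r : R, 0 < r & e = 2 * r.
  by exists (e / 2); [rewrite divr_gt0|field].
have [w [xw Dw]] : (ball (eigJ_val x).1 r `&` D) !=set0.
  apply: dD; first by exists (eigJ_val x).1; exact: ballxx.
  exact: ball_open.
have : rdt x (x - real_to_Hp w) = nsq x.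
  by rewrite rdtDr rdtNr -/(nsq x) /rdt -(vD _ Dw) [hdot _ _]hx subr0.
have := rdt_le x (x - real_to_Hp w) => h hn; move: h; rewrite {}hn -nrm2.
have hr : nrm (x - real_to_Hp w) < e.
  rewrite -{1}[x]real_to_HpK -[e]gtr0_norm// -sqrtr_sqr ltr_sqrt ?exprn_gt0//.
  rewrite nsq_real_to_Hp_sub.
  move: xw; rewrite -ball_normE /ball_ /= => xw.
  have : `|(eigJ_val x).1 - w| ^+ 2 < r ^+ 2 by rewrite ltr_sqr ?nnegrE ?normr_ge0 ?(ltW r0).
  by rewrite er exprMn; move: (_ ^+ 2) => z zr; have := sqr_ge0 r; nra.
rewrite expr2; have := nrm_ge0 x; rewrite le_eqVlt => /orP[/eqP<-//|x0].
by rewrite ler_pM2l// => /le_lt_trans; apply.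
Qed.

(** The real part of a complex combination of [l] is a real combination of the [2 m] real and
    imaginary parts of its members, with coefficients [Re c] and [- Im c]. A [v] outside their real
    span therefore has its image outside the span of [l]. *)
Lemma Hp_not_spanned (V_infinite : infinite_dimensional V) (l : seq Hp) :
  exists x : Hp, x != \sum_(z <- l) hdot x z *: z.
Proof.
pose m := size l.
pose a (i : 'I_m) : V := (eigJ_val (nth 0 l i)).1.
pose b (i : 'I_m) : V := (eigJ_val (nth 0 l i)).2.
pose ab (i : 'I_(m + m)) := match fintype.split i with inl j => a j | inr j => b j end.
have [v hv] := V_infinite _ ab.
exists (real_to_Hp v); apply/eqP => hl.
pose c i := hdot (real_to_Hp v) (nth 0 l i).
pose rc (i : 'I_(m + m)) := match fintype.split i with
  inl j => complex.Re (c j) | inr j => - complex.Im (c j) end.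
have E1 (j : 'I_m) : fintype.split (lshift m j) = inl j by exact: (unsplitK (inl j)).
have E2 (j : 'I_m) : fintype.split (rshift m j) = inr j by exact: (unsplitK (inr j)).
pose h (p : Hp) := (eigJ_val p).1.
have hv1 : v = \sum_(j < m) (complex.Re (c j) *: a j - complex.Im (c j) *: b j).
  transitivity (h (real_to_Hp v)) => //.
  rewrite [in LHS]hl (big_nth 0) big_mkord.
  by rewrite (big_morph h (id1 := 0) (op1 := +%R)).
apply: (hv rc); rewrite [LHS]hv1 big_split_ord big_split /=; congr (_ + _);
  apply: eq_bigr => j _; rewrite /rc /ab ?E1 ?E2 ?scaleNr //.
Qed.

Lemma Hp_onb (V_separable : separable V) (V_infinite : infinite_dimensional V) :
  exists f : nat -> Hp, orthonormal_basis f.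
Proof.
have [d hd] := Hp_total V_separable.
exact: orthonormal_basis_exists hd (Hp_not_spanned V_infinite).
Qed.

Lemma hdot_conj_pm (p q : Hp) : hdot (conj_pm p) (conj_pm q) = (hdot p q)^*.
Proof.
rewrite !hdot_eigJ; congr Complex => /=.
  by rewrite linearNl linearNr opprK.
by rewrite linearNl linearNr opprB addrC opprK.
Qed.

Lemma conj_pmK : cancel (@conj_pm R V) (@conj_mp R V).
Proof. by move=> p; apply: val_inj; case: p => -[x y] yp; rewrite /= /conjH /= opprK. Qed.

Lemma conj_mpK : cancel (@conj_mp R V) (@conj_pm R V).
Proof. by move=> p; apply: val_inj; case: p => -[x y] yp; rewrite /= /conjH /= opprK. Qed.

(** Supplies H_- with a basis, needed for the Hilbert-Schmidt norm of the off-diagonal block. *)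
Lemma conj_pm_onb (f : nat -> Hp) :
  orthonormal_basis f -> orthonormal_basis (@conj_pm R V \o f).
Proof.
move=> [of0 cf]; split=> [i j|x hx]; first by rewrite /= hdot_conj_pm of0 rmorph_nat.
have : conj_mp x = 0.
  apply: cf => i; rewrite -[LHS]conjCK -hdot_conj_pm conj_mpK.
  by rewrite [hdot _ _]hx conjC0.
move/(congr1 (@conj_pm R V)); rewrite conj_mpK => ->.
by apply: val_inj; rewrite /= /conjH /= oppr0.
Qed.

End EigenspaceBasis.

(** * Block operators and the embedding of unitaries *)

Section Blocks.
Context {R : realType} {V : hilbertJType R}.
Local Notation H := (cplx V).
Local Notation Hp := (eigJ V true).
Local Notation Hm := (eigJ V false).
Local Notation val := (@eigJ_val R V _).

Lemma projJ_linear s : linear (@projJ R V s).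
Proof.
move=> a x y; apply: val_inj => /=.
rewrite Jc_linear scalerA mulrC -scalerA -scalerDr; congr (_ *: _).
by rewrite scalerBr scalerDr opprD addrACA !scalerA [_ * a]mulrC.
Qed.

Lemma scale_half_mul2n (x : H) : (2^-1 : R[i]) *: (x *+ 2) = x.
Proof.
by rewrite -(@scaler_nat R[i] H) scalerA mulVf ?scale1r// pnatr_eq0.
Qed.

Lemma projJK (x : H) : val (projJ true x) + val (projJ false x) = x.
Proof.
rewrite /= -scalerDr scaleNr opprK addrACA addNr addr0 -mulr2n.
exact: scale_half_mul2n.
Qed.

Lemma projJ_inj (x y : H) :
  projJ true x = projJ true y -> projJ false x = projJ false y -> x = y.
Proof. by move=> p m; rewrite -[x]projJK p m projJK. Qed.

Lemma ipmN s : ipm (~~ s) = - ipm s :> R[i].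
Proof. by case: s; rewrite /ipm ?opprK. Qed.

Lemma ipm2 s : ipm s * ipm s = -1 :> R[i].
Proof. by case: s; rewrite /ipm ?mulrNN -expr2 sqrCi. Qed.

Lemma projJ_id s (p : eigJ V s) : projJ s (val p) = p.
Proof.
apply: val_inj; rewrite /= eigJP scalerA ipm2 scaleN1r opprK -mulr2n.
exact: scale_half_mul2n.
Qed.

Lemma projJ_eq0 s (p : eigJ V (~~ s)) : projJ s (val p) = 0.
Proof.
apply: val_inj; rewrite /= eigJP ipmN scalerA mulrN ipm2 opprK scale1r subrr.
by rewrite scaler0.
Qed.

Lemma projJ_sum_p (p : Hp) (m : Hm) : projJ true (val p + val m) = p.
Proof. by rewrite (linD (projJ_linear _)) projJ_id (projJ_eq0 (s := true)) addr0. Qed.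

Lemma projJ_sum_m (p : Hp) (m : Hm) : projJ false (val p + val m) = m.
Proof. by rewrite (linD (projJ_linear _)) projJ_id (projJ_eq0 (s := false)) add0r. Qed.

Lemma cdot_Jc (x y : H) : hdot (Jc x) (Jc y) = hdot x y.
Proof. by congr Complex; rewrite /= !Jop_isometry. Qed.

(** [J] preserves the scalar product and has eigenvalues [i] and [- i], so
    [<p, m> = <J p, J m> = - <p, m>]. *)
Lemma hdot_pm (p : Hp) (m : Hm) : hdot (val p) (val m) = 0.
Proof.
have := cdot_Jc (val p) (val m).
rewrite !eigJP hdotZl hdotZr mulrA (ipmN true) rmorphN /= conjCi opprK.
rewrite (ipm2 true) mulN1r => /eqP; rewrite eq_sym -addr_eq0 -mulr2n mulrn_eq0 /=.
by move=> /eqP.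
Qed.

Lemma hdot_projJ (x y : H) : hdot x y =
  hdot (projJ true x) (projJ true y) + hdot (projJ false x) (projJ false y).
Proof.
rewrite -{1}[x]projJK -{1}[y]projJK hdotDl !hdotDr hdot_pm addr0.
by rewrite [hdot (eigJ_val (projJ false x)) (eigJ_val (projJ true y))]hdotC
  hdot_pm conjC0 add0r.
Qed.

Lemma hdot_val s (p : eigJ V s) (x : H) : hdot (val p) x = hdot p (projJ s x).
Proof.
rewrite hdot_projJ; case: s p => p.
  by rewrite projJ_id (projJ_eq0 (s := false)) linear0l addr0.
by rewrite projJ_id (projJ_eq0 (s := true)) linear0l add0r.
Qed.

Lemma nsq_projJ (x : H) : nsq x = nsq (projJ true x) + nsq (projJ false x).
Proof. by rewrite {1}/nsq /rdt hdot_projJ ReD. Qed.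

Lemma bounded_val s : bounded_op (@eigJ_val R V s).
Proof. by apply/bounded_opP; split=> //; exists 1 => // x; rewrite mul1r. Qed.

Lemma bounded_projJ s : bounded_op (@projJ R V s).
Proof.
apply/bounded_opP; split; first exact: projJ_linear.
exists 1 => // x; rewrite mul1r nrm_le ?nrm_ge0// nrm2 nsq_projJ.
by case: s; rewrite (lerDl, lerDr) nsq_ge0.
Qed.

Lemma block_op_p (A : Hp -> Hp) (B : Hm -> Hp) (C : Hp -> Hm) (D : Hm -> Hm) x :
  projJ true (block_op A B C D x) = A (projJ true x) + B (projJ false x).
Proof. exact: projJ_sum_p. Qed.

Lemma block_op_m (A : Hp -> Hp) (B : Hm -> Hp) (C : Hp -> Hm) (D : Hm -> Hm) x :
  projJ false (block_op A B C D x) = C (projJ true x) + D (projJ false x).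
Proof. exact: projJ_sum_m. Qed.

Lemma block_op_id : block_op id (cst 0) (cst 0) id = id :> (H -> H).
Proof. by apply/funext => x; rewrite /block_op addr0 add0r projJK. Qed.

Lemma block_op_add (A A' : Hp -> Hp) (B B' : Hm -> Hp) (C C' : Hp -> Hm)
    (D D' : Hm -> Hm) :
  block_op A B C D + block_op A' B' C' D' =
  block_op (A + A') (B + B') (C + C') (D + D').
Proof.
apply/funext => x; apply: projJ_inj;
  rewrite [X in projJ _ X = _]/(block_op A B C D x + block_op A' B' C' D' x).
  by rewrite (linD (projJ_linear _)) !block_op_p addrACA.
by rewrite (linD (projJ_linear _)) !block_op_m addrACA.
Qed.

Lemma block_op_comp_diag (A : Hp -> Hp) (B : Hm -> Hp) (C : Hp -> Hm)
    (D : Hm -> Hm) (u : Hp -> Hp) (w : Hm -> Hm) :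
  block_op A B C D \o block_op u (cst 0) (cst 0) w =
  block_op (A \o u) (B \o w) (C \o u) (D \o w).
Proof.
by apply/funext => x; rewrite /= /block_op projJ_sum_p projJ_sum_m addr0 add0r.
Qed.

Lemma diag_comp_block_op (A : Hp -> Hp) (B : Hm -> Hp) (C : Hp -> Hm)
    (D : Hm -> Hm) (u : Hp -> Hp) (w : Hm -> Hm) : linear u -> linear w ->
  block_op u (cst 0) (cst 0) w \o block_op A B C D =
  block_op (u \o A) (u \o B) (w \o C) (w \o D).
Proof.
move=> lu lw; apply/funext => x; rewrite /= /block_op projJ_sum_p projJ_sum_m.
by rewrite addr0 add0r (linD lu) (linD lw).
Qed.

Lemma conj_pmD (p q : Hp) : conj_pm (p + q) = conj_pm p + conj_pm q.
Proof. by apply: val_inj; rewrite /= /conjH /= opprD. Qed.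

Lemma conj_pmZ a (p : Hp) : conj_pm (a *: p) = a^* *: conj_pm p.
Proof. by apply: val_inj; rewrite /= conjHZ. Qed.

Lemma conj_mpD (p q : Hm) : conj_mp (p + q) = conj_mp p + conj_mp q.
Proof. by apply: val_inj; rewrite /= /conjH /= opprD. Qed.

Lemma conj_mpZ a (p : Hm) : conj_mp (a *: p) = a^* *: conj_mp p.
Proof. by apply: val_inj; rewrite /= conjHZ. Qed.

Lemma nrm_conj_pm (p : Hp) : nrm (conj_pm p) = nrm p.
Proof. by rewrite /nrm /nsq /rdt hdot_conj_pm complexRe_conj. Qed.

Lemma nrm_conj_mp (p : Hm) : nrm (conj_mp p) = nrm p.
Proof. by rewrite -{2}[p]conj_mpK nrm_conj_pm. Qed.

Lemma bar_pp_comp (A B : Hp -> Hp) : bar_pp (A \o B) = bar_pp A \o bar_pp B.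
Proof. by apply/funext => x; rewrite /= /bar_pp /= conj_pmK. Qed.

Lemma bar_mp_compr (A : Hm -> Hp) (u : Hp -> Hp) :
  bar_mp (A \o bar_pp u) = bar_mp A \o u.
Proof. by apply/funext => x; rewrite /bar_mp /bar_pp /= conj_pmK. Qed.

Lemma bar_mp_compl (A : Hm -> Hp) (u : Hp -> Hp) :
  bar_mp (u \o A) = bar_pp u \o bar_mp A.
Proof. by apply/funext => x; rewrite /bar_mp /bar_pp /= conj_pmK. Qed.

Lemma bar_pp_add (A B : Hp -> Hp) : bar_pp (A + B) = bar_pp A + bar_pp B.
Proof. by apply/funext => x; exact: conj_pmD. Qed.

Lemma bar_pp_id : bar_pp id = id :> (Hm -> Hm).
Proof. by apply/funext => x; exact: conj_mpK. Qed.

Lemma bounded_bar_pp (A : Hp -> Hp) : bounded_op A -> bounded_op (bar_pp A).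
Proof.
move=> /bounded_opP[lA [c c0 hA]]; apply/bounded_opP; split=> [a x y|].
  rewrite /bar_pp /= conj_mpD conj_mpZ (linD lA) (linZ lA) conj_pmD conj_pmZ.
  by rewrite conjCK.
by exists c => // x; rewrite /bar_pp /= nrm_conj_pm -(nrm_conj_mp x).
Qed.

Lemma bar_pp_is_adjoint (A B : Hp -> Hp) :
  is_adjoint A B -> is_adjoint (bar_pp A) (bar_pp B).
Proof.
move=> [bB AB]; split; first exact: bounded_bar_pp.
move=> x y; rewrite /bar_pp /= -{1}[y]conj_mpK hdot_conj_pm AB.
by rewrite -hdot_conj_pm conj_mpK.
Qed.

Lemma bar_pp_unitary (u : Hp -> Hp) : unitary u -> unitary (bar_pp u).
Proof.
move=> uu; have [bu h1 h2] := uu.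
apply: (unitaryP (bounded_bar_pp bu) (bar_pp_is_adjoint (unitary_is_adjoint uu)));
by rewrite -bar_pp_comp ?h1 ?h2 bar_pp_id.
Qed.

Lemma bounded_block_op (A : Hp -> Hp) (B : Hm -> Hp) (C : Hp -> Hm)
    (D : Hm -> Hm) : bounded_op A -> bounded_op B -> bounded_op C ->
  bounded_op D -> bounded_op (block_op A B C D).
Proof.
move=> bA bB bC bD.
have bp := bounded_projJ true; have bm := bounded_projJ false.
apply: (@bounded_add _ _ _
  (@eigJ_val R V true \o ((A \o @projJ R V true) + (B \o @projJ R V false)))
  (@eigJ_val R V false \o ((C \o @projJ R V true) + (D \o @projJ R V false))));
apply: bounded_comp; try exact: bounded_val;
by apply: bounded_add; apply: bounded_comp.
Qed.

Lemma U1_embed_comp (u v : Hp -> Hp) :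
  U1_embed u \o U1_embed v = U1_embed (u \o v).
Proof.
by rewrite /U1_embed block_op_comp_diag bar_pp_comp.
Qed.

Lemma U1_embed_id : U1_embed id = id :> (H -> H).
Proof. by rewrite /U1_embed bar_pp_id block_op_id. Qed.

Lemma U1_embed_p (u : Hp -> Hp) x : projJ true (U1_embed u x) = u (projJ true x).
Proof. by rewrite block_op_p addr0. Qed.

Lemma U1_embed_m (u : Hp -> Hp) x :
  projJ false (U1_embed u x) = bar_pp u (projJ false x).
Proof. by rewrite block_op_m add0r. Qed.

Lemma U1_embed_val_p (u : Hp -> Hp) (p : Hp) : linear u ->
  U1_embed u (val p) = val (u p).
Proof.
move=> lu; have lb : linear (bar_pp u).
  by move=> a x y; rewrite /bar_pp /= conj_mpD conj_mpZ (linD lu) (linZ lu)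
    conj_pmD conj_pmZ conjCK.
rewrite -[LHS]projJK U1_embed_p U1_embed_m projJ_id (projJ_eq0 (s := false)).
by rewrite (lin0 lb) addr0.
Qed.

Lemma U1_embed_val_m (u : Hp -> Hp) (m : Hm) : linear u ->
  U1_embed u (val m) = val (bar_pp u m).
Proof.
move=> lu; rewrite -[LHS]projJK U1_embed_p U1_embed_m projJ_id.
by rewrite (projJ_eq0 (s := true)) (lin0 lu) add0r.
Qed.

Lemma U1_embed_is_adjoint (u u' : Hp -> Hp) :
  is_adjoint u u' -> is_adjoint (U1_embed u) (U1_embed u').
Proof.
move=> uu'; have [bb hb] := bar_pp_is_adjoint uu'; have [bu hu] := uu'.
split; first by apply: bounded_block_op => //; exact: bounded_cst0.
by move=> x y; rewrite !hdot_projJ !U1_embed_p !U1_embed_m hu hb.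
Qed.

Lemma U1_embed_unitary (u : Hp -> Hp) : unitary u -> unitary (U1_embed u).
Proof.
move=> uu; have [bu h1 h2] := uu.
apply: (unitaryP _ (U1_embed_is_adjoint (unitary_is_adjoint uu))).
- apply: bounded_block_op => //; try exact: bounded_cst0.
  exact: bounded_bar_pp.
- by rewrite U1_embed_comp h1 U1_embed_id.
- by rewrite U1_embed_comp h2 U1_embed_id.
Qed.

Lemma adj_U1_embed (u : Hp -> Hp) :
  unitary u -> adj (U1_embed u) = U1_embed (adj u).
Proof. by move=> /unitary_is_adjoint/U1_embed_is_adjoint/adjE. Qed.

Lemma projJ_Jc (x : H) : projJ true (Jc x) = ipm true *: projJ true x.
Proof.
rewrite -{1}[x]projJK; move: (projJ true x) (projJ false x) => p m.
rewrite (linD (@Jc_linear R V)) !eigJP.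
exact: (projJ_sum_p (ipm true *: p) (ipm false *: m)).
Qed.

Lemma Jc_U1_embed (u : Hp -> Hp) : bounded_op u ->
  @Jc R V \o U1_embed u = U1_embed u \o @Jc R V.
Proof.
move=> bu; have [lu _] := bu; have [lb _] := bounded_bar_pp bu.
apply/funext => x /=; rewrite -[X in Jc X]projJK -[X in U1_embed u (Jc X)]projJK.
have [lU _] : bounded_op (U1_embed u).
  apply: bounded_block_op => //; try exact: bounded_cst0.
  exact: bounded_bar_pp.
rewrite U1_embed_p U1_embed_m; move: (projJ true x) (projJ false x) => p m.
rewrite !(linD (@Jc_linear R V)) !eigJP (linD lU) !(linZ lU).
by rewrite U1_embed_val_p// U1_embed_val_m.
Qed.

End Blocks.

(** * The restricted group, its tangent space and the action *)

Section RestrictedGroup.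
Context {R : realType} {V : hilbertJType R}.
Local Notation H := (cplx V).
Local Notation Hp := (eigJ V true).
Local Notation Hm := (eigJ V false).

Lemma trace_class_cst0 (E F : hermitianSpaceType R[i]) :
  trace_class (cst 0 : E -> F).
Proof.
apply: trace_class_no_adjoint; first exact: bounded_cst0.
exact: (adjE (is_adjoint_cst0 E F)).
Qed.

Lemma hilbert_schmidt_unitary_comp (E F : hermitianSpaceType R[i]) (u : F -> F)
    (A : E -> F) : unitary u -> hilbert_schmidt A -> hilbert_schmidt (u \o A).
Proof.
move=> uu [bA [t tA]]; split; first by apply: bounded_comp => //; case: uu.
by exists t; rewrite adj_unitary_compK.
Qed.

(** The identity is absorbed into the diagonal blocks, [bar_pp] fixing it; elements of [M12] then
    compose block by block. *)
Lemma M12P (a : H -> H) : M12 a <-> exists A1 A2,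
  [/\ trace_class (A1 - idfun), hilbert_schmidt A2
    & a = block_op A1 A2 (bar_mp A2) (bar_pp A1)].
Proof.
have idD (A1 : Hp -> Hp) A2 : idfun + block_op A1 A2 (bar_mp A2) (bar_pp A1) =
    block_op (idfun + A1) A2 (bar_mp A2) (bar_pp (idfun + A1)) :> (H -> H).
  rewrite bar_pp_add; have -> : bar_pp idfun = id := @bar_pp_id R V.
  rewrite -{1}[idfun : H -> H](@block_op_id R V) block_op_add.
  have -> : cst 0 + A2 = A2 by exact: add0r.
  by have -> : cst 0 + bar_mp A2 = bar_mp A2 by exact: add0r.
split=> [[X [A1 [A2 [tA hA ->]]] <-]|[A1 [A2 [tA hA ->]]]].
  by exists (idfun + A1), A2; rewrite addrAC subrr add0r idD.
exists (block_op (A1 - idfun) A2 (bar_mp A2) (bar_pp (A1 - idfun))).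
  by exists (A1 - idfun), A2.
by rewrite idD addrC subrK.
Qed.

Lemma U1_is_adjoint_sub (u : Hp -> Hp) :
  unitary u -> is_adjoint (u - idfun) (adj u - idfun).
Proof.
by move=> /unitary_is_adjoint uu; exact: is_adjoint_add uu
  (is_adjoint_opp (@is_adjoint_id _ _)).
Qed.

Lemma M12_comp_embed (a : H -> H) (u : Hp -> Hp) :
  U1 V u -> M12 a -> M12 (a \o U1_embed u).
Proof.
move=> [uu tu] /M12P[A1 [A2 [tA hA ->]]]; apply/M12P.
exists (A1 \o u), (A2 \o bar_pp u); split.
(* The summand [u - 1] is placed second because [trace_class_add] wants an explicit adjoint of its
   second argument, and this one has [adj u - 1]. *)
- have -> : A1 \o u - idfun = ((A1 - idfun) \o u) + (u - idfun).
    apply/funext => x.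
    change (A1 (u x) - x = (A1 (u x) - u x) + (u x - x)).
    by rewrite addrA subrK.
  apply: (trace_class_add (@eigJ_complete R V true) (U1_is_adjoint_sub uu)) => //.
  exact: trace_class_comp_unitary.
- by apply: hilbert_schmidt_comp_unitary => //; exact: bar_pp_unitary.
- by rewrite /U1_embed block_op_comp_diag bar_mp_compr (bar_pp_comp A1 u).
Qed.

Lemma M12_embed_comp (a : H -> H) (u : Hp -> Hp) :
  U1 V u -> M12 a -> M12 (U1_embed u \o a).
Proof.
move=> [uu tu] /M12P[A1 [A2 [tA hA ->]]]; apply/M12P.
have [bu _ _] := uu; have [lu _] := bu.
exists (u \o A1), (u \o A2); split.
- have -> : u \o A1 - idfun = (u \o (A1 - idfun)) + (u - idfun).
    apply/funext => x.
    change (u (A1 x) - x = u (A1 x - x) + (u x - x)).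
    by rewrite (linB lu) addrA subrK.
  apply: (trace_class_add (@eigJ_complete R V true) (U1_is_adjoint_sub uu)) => //.
  exact: trace_class_unitary_comp.
- exact: hilbert_schmidt_unitary_comp.
- rewrite /U1_embed diag_comp_block_op// ?bar_mp_compl ?(bar_pp_comp u A1)//.
  by case: (bounded_bar_pp bu).
Qed.

(* [u^* - 1 = - u^* (u - 1)]. *)
Lemma U1_adj (u : Hp -> Hp) : U1 V u -> U1 V (adj u).
Proof.
move=> [uu tu]; split; first exact: unitary_adj.
have [_ h1 _] := uu; have [[lu' _] _] := unitary_is_adjoint uu.
have -> : adj u - idfun = (- adj u) \o (u - idfun).
  apply/funext => x; change (adj u x - x = - adj u (u x - x)).
  by rewrite (linB lu') (comp_at h1) opprB.
by apply: trace_class_unitary_comp => //; apply/unitary_opp/unitary_adj.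
Qed.

Lemma GL12_comp_embed (a : H -> H) (u : Hp -> Hp) :
  U1 V u -> GL12 V a -> GL12 V (a \o U1_embed u).
Proof.
move=> Uu [Ma [b [Mb ab ba]]]; have [[bu h1 h2] _] := Uu.
split; first exact: M12_comp_embed.
exists (U1_embed (adj u) \o b); split.
- by apply: M12_embed_comp => //; exact: U1_adj.
- rewrite -compA [X in a \o X]compA U1_embed_comp h2 U1_embed_id.
  exact: ab.
- rewrite -compA [X in _ \o X]compA ba.
  by have -> : id \o U1_embed u = U1_embed u by []; rewrite U1_embed_comp h1 U1_embed_id.
Qed.

Lemma GL12_id : GL12 V id.
Proof.
suff M : M12 (id : H -> H) by split=> //; exists id.
apply/M12P; exists id, (cst 0); split.
- by have -> : id - idfun = cst 0 :> (Hp -> Hp);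
    [exact: subrr|exact: trace_class_cst0].
- exact: hilbert_schmidt_cst0.
- have -> : bar_mp (cst 0) = cst 0 :> (Hp -> Hm).
    by apply/funext => x; apply: val_inj; rewrite /= /conjH /= oppr0.
  by rewrite bar_pp_id block_op_id.
Qed.

Lemma gl12_comp_embed (X : H -> H) (u : Hp -> Hp) :
  unitary u -> gl12 X -> gl12 (X \o U1_embed u).
Proof.
move=> uu [A1 [A2 [tA hA ->]]].
exists (A1 \o u), (A2 \o bar_pp u); split.
- exact: trace_class_comp_unitary.
- by apply: hilbert_schmidt_comp_unitary => //; exact: bar_pp_unitary.
- by rewrite /U1_embed block_op_comp_diag bar_mp_compr (bar_pp_comp A1 u).
Qed.

Lemma gl12_norm_comp_embed (X : H -> H) (u : Hp -> Hp) :
  unitary u -> gl12_norm (X \o U1_embed u) = gl12_norm X.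
Proof.
move=> uu; have [[lu _] _ _] := uu.
rewrite /gl12_norm.
have -> : blk_pp (X \o U1_embed u) = blk_pp X \o u.
  by apply/funext => x; rewrite /blk_pp /= U1_embed_val_p.
have -> : blk_mp (X \o U1_embed u) = blk_mp X \o bar_pp u.
  by apply/funext => x; rewrite /blk_mp /= U1_embed_val_m.
by rewrite trace_norm_unitary// hs_norm_unitary//; exact: bar_pp_unitary.
Qed.

Lemma gl12_0 : gl12 (0 : H -> H).
Proof.
exists (cst 0), (cst 0); split; first exact: trace_class_cst0.
  exact: hilbert_schmidt_cst0.
apply/funext => x; apply: projJ_inj.
  by rewrite block_op_p (lin0 (@projJ_linear R V true)) addr0.
rewrite block_op_m (lin0 (@projJ_linear R V false)).
by apply: val_inj; rewrite /= /conjH /= oppr0 addr0.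
Qed.

(* Without an orthonormal basis [has_trace] is vacuous and the norms are
   arbitrary, even that of [0]. *)
Section Norm.
Hypothesis onb : exists f : nat -> Hp, orthonormal_basis f.

Lemma trace_norm_ge0 (A : Hp -> Hp) : 0 <= trace_norm A.
Proof.
have [f bf] := onb; rewrite /trace_norm; case: xgetP => // t _ [P [pP _] tP].
exact: positive_trace_ge0 bf pP tP.
Qed.

(** A positive [P] with [P \o P = 0] vanishes, since [|P x|^2 = <x, P (P x)>]; the basis then leaves
    0 as its only trace. *)
Lemma trace_norm_cst0 : trace_norm (cst 0 : Hp -> Hp) = 0.
Proof.
have [f bf] := onb; have a0 := adjE (is_adjoint_cst0 Hp Hp).
apply: xget_unique.
  exists (cst 0); last exact: has_trace_cst0.
  by split; [exact: positive_cst0|rewrite a0].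
move=> t [P [pP PP] tP]; suff P0 : P = cst 0.
  by apply: (has_trace_uniq bf tP); rewrite P0; exact: has_trace_cst0.
apply/funext => x; apply: nsq_eq0.
have PPx : P (P x) = 0 by rewrite (comp_at PP) a0.
by rewrite /nsq /rdt; case: (positive_is_adjoint pP) => _ ->; rewrite PPx linear0r.
Qed.

Lemma hs_norm_ge0 (A : Hm -> Hp) : bounded_op A -> 0 <= hs_norm A.
Proof.
have [f /conj_pm_onb bf] := onb; move=> bA.
rewrite /hs_norm sqrtC_ge0 /trace; case: xgetP => // t _.
apply: positive_trace_ge0 bf _.
have [AA|[-> _]] := adjP A.
  split; first by apply: bounded_comp => //; case: AA.
  move=> x; have [_ h] := is_adjoint_sym bA AA.
  by rewrite [hdot _ _]h hdotxx ler0c nsq_ge0.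
exact: positive_cst0.
Qed.

Lemma hs_norm_cst0 : hs_norm (cst 0 : Hm -> Hp) = 0.
Proof.
have [f /conj_pm_onb bf] := onb.
rewrite /hs_norm (adjE (is_adjoint_cst0 Hm Hp)); apply/eqP; rewrite sqrtC_eq0.
apply/eqP/xget_unique; first exact: has_trace_cst0.
by move=> t tt; apply: (has_trace_uniq bf tt); exact: has_trace_cst0.
Qed.

Lemma gl12_norm0 : gl12_norm (0 : H -> H) = 0.
Proof.
rewrite /gl12_norm.
have -> : blk_pp (0 : H -> H) = cst 0.
  by apply/funext => x; exact: (lin0 (@projJ_linear R V true)).
have -> : blk_mp (0 : H -> H) = cst 0.
  by apply/funext => x; exact: (lin0 (@projJ_linear R V true)).
by rewrite trace_norm_cst0 hs_norm_cst0 addr0.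
Qed.

Lemma gl12_norm_ge0 (X : H -> H) : gl12 X -> 0 <= gl12_norm X.
Proof.
move=> [A1 [A2 [[bA1 _] [bA2 _] ->]]].
have : 0 <= trace_norm (blk_pp (block_op A1 A2 (bar_mp A2) (bar_pp A1))) +
    hs_norm (blk_mp (block_op A1 A2 (bar_mp A2) (bar_pp A1))).
  rewrite addr_ge0 ?trace_norm_ge0// hs_norm_ge0//.
  have -> : blk_mp (block_op A1 A2 (bar_mp A2) (bar_pp A1)) = A2.
    apply/funext => m; rewrite /blk_mp block_op_p projJ_id.
    rewrite (projJ_eq0 (s := true)) (lin0 (A := A1)) ?add0r//.
    by case: bA1.
  by [].
by rewrite lecE => /andP[].
Qed.

End Norm.

Lemma U1_embed_O_Sp (u : Hp -> Hp) :
  U1 V u -> (O12 V `&` Sp12 V) (U1_embed u).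
Proof.
move=> Uu; have G : GL12 V (U1_embed u) := GL12_comp_embed Uu GL12_id.
have [uu _] := Uu; have [bu h1 h2] := uu.
have UU : adj (U1_embed u) \o U1_embed u = id.
  by rewrite adj_U1_embed// U1_embed_comp h1 U1_embed_id.
split; split=> //.
by rewrite -compA Jc_U1_embed// compA UU.
Qed.

Lemma O_Sp_U1_embed (a : H -> H) :
  (O12 V `&` Sp12 V) a -> exists2 u, U1 V u & U1_embed u = a.
Proof.
move=> [[[/M12P[A1 [A2 [tA [bA2 _] aE]]] [b [_ ab ba]]] a'a] [_ a'Ja]].
(* The left inverse [adj a] agrees with the two-sided inverse provided by [GL12], so
   [a \o adj a = id] too. Applying [a] to [adj a J a = J] then shows that [a] commutes with [J]. *)
have a'b : adj a = b by rewrite -[RHS]/(id \o b) -a'a -compA ab.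
have aa' : a \o adj a = id by rewrite a'b.
have Ja x : Jc (a x) = a (Jc x).
  by rewrite -(comp_at a'Ja x) /= (comp_at aa').
have bA1 : bounded_op A1.
  have -> : A1 = (A1 - idfun) + idfun by rewrite subrK.
  by apply: bounded_add; [case: tA|exact: bounded_id].
have A20 : A2 = cst 0.
  have lA1 : linear A1 by case: bA1.
  have lA2 : linear A2 by case: bA2.
  apply/funext => m.
  have ap x : projJ true (a x) = A1 (projJ true x) + A2 (projJ false x).
    by rewrite aE block_op_p.
  (* For [m] in H_-, the H_+ components of [J (a m)] and [a (J m)] are [i A2 m] and [- i A2 m];
     hence [A2 m = 0]. *)
  have := congr1 (projJ true) (Ja (eigJ_val m)).
  rewrite ap eigJP !(linZ (projJ_linear _)) projJ_id (projJ_eq0 (s := true)).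
  rewrite scaler0 (lin0 lA1) add0r (linZ lA2).
  have -> : projJ true (Jc (a (eigJ_val m))) = ipm true *: A2 m.
    by rewrite projJ_Jc ap projJ_id (projJ_eq0 (s := true)) (lin0 lA1) add0r.
  rewrite (ipmN true) scaleNr => /eqP; rewrite -addr_eq0 -scalerDr scaler_eq0.
  rewrite -mulr2n => /orP[/eqP i0|/eqP A2m].
    have := ipm2 (R := R) true; rewrite i0 mul0r => /eqP.
    by rewrite eq_sym oppr_eq0 oner_eq0.
  have := scale_half_mul2n (eigJ_val (A2 m)).
  have -> : eigJ_val (A2 m) *+ 2 = eigJ_val (A2 m *+ 2) by [].
  by rewrite A2m scaler0 => h; apply: val_inj; exact: (esym h).
have aU : a = U1_embed A1.
  rewrite aE A20 /U1_embed; congr block_op.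
  by apply/funext => x; apply: val_inj; rewrite /= /conjH /= oppr0.
exists A1 => //; split=> //.
have ua : unitary a.
  split=> //; rewrite aU; apply: bounded_block_op => //; try exact: bounded_cst0.
  exact: bounded_bar_pp.
have [ba' ha'] := unitary_is_adjoint ua.
have lA1 : linear A1 by case: bA1.
have av p : a (eigJ_val p) = eigJ_val (A1 p) by rewrite aU U1_embed_val_p.
(* The adjoint of [A1] is the compression of [adj a] to H_+, as [projJ true] is adjoint to the
   inclusion. *)
apply: (@unitaryP _ _ A1 (@projJ R V true \o adj a \o @eigJ_val R V true)) => //.
- split.
    apply: bounded_comp; last exact: bounded_val.
    by apply: bounded_comp => //; exact: bounded_projJ.
  by move=> x y; rewrite hdot_eigJ -av ha' hdot_val.
- by apply/funext => x; rewrite /= -av (comp_at a'a) projJ_id.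
- apply/funext => y; rewrite /=.
  have <- : projJ true (a (adj a (eigJ_val y))) = A1 (projJ true (adj a (eigJ_val y))).
    by rewrite {1}aU U1_embed_p.
  by rewrite (comp_at aa') projJ_id.
Qed.

Lemma right_mul_preserves_kaehler (u : Hp -> Hp) :
  (exists f : nat -> Hp, orthonormal_basis f) ->
  U1 V u -> preserves_kaehler (right_mul u).
Proof.
move=> onb [uu _] a _; exists (right_mul u).
have UU := U1_embed_unitary uu.
split; last first.
  (* Compatibility with [JM] is associativity of composition and holds by conversion. *)
  move=> X Y _ _; split=> //.
    by rewrite /gM /right_mul adj_comp_comp_unitary// trace_conj.
  rewrite /omegaM /right_mul -(trace_conj UU (adj X \o @Jc R V \o Y)).
  by rewrite adj_comp_unitary.
split=> //.
- by move=> X; exact: gl12_comp_embed.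
- by exists 1 => X gX; rewrite mul1r gl12_norm_comp_embed.
(* The remainder is identically 0, so any [delta] would do; what is left is that [gl12_norm]
   vanishes at 0 and is nonnegative on [gl12]. *)
- move=> eps e0; exists 1 => // X gX _ _.
  have -> : right_mul u (a + X) - right_mul u a - right_mul u X = 0.
    by apply/eqP; rewrite -addrA -opprD subr_eq0.
  rewrite gl12_norm0//; split; first exact: gl12_0.
  by rewrite mulr_ge0 ?gl12_norm_ge0// ltW.
Qed.

End RestrictedGroup.

Theorem proposition2 (R : realType) (V : hilbertJType R)
    (V_separable : separable V) (V_infinite : infinite_dimensional V) :
  [/\ [set U1_embed u | u in U1 V] = O12 V `&` Sp12 V,
      is_right_action (@right_mul R V)
    & forall u, U1 V u -> preserves_kaehler (right_mul u)].
Proof.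
split.
- apply/seteqP; split=> [_ [u Uu <-]|a /O_Sp_U1_embed[u Uu <-]].
    exact: U1_embed_O_Sp.
  by exists u.
- split=> [u a|a _|u v a _ _ _]; first exact: GL12_comp_embed.
    by rewrite /right_mul U1_embed_id.
  by rewrite /right_mul -U1_embed_comp.
- by move=> u; apply: right_mul_preserves_kaehler; exact: Hp_onb.
Qed.
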